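(* For odd $\ell\ge 3$ let $G^4_{3\times\ell}$ be the subgraph of the $\ell\times\ell$ grid graph induced by the set of vertices at graph distance at most $1$ from the middle row or the middle column. Then each $G^4_{3\times\ell}$ is a 2-connected subgraph of the grid of bandwidth at most $12$, the Glauber dynamics $\mathcal{M}$ on the set of contiguous $2$-partitions of $G^4_{3\times\ell}$ is ergodic, and its mixing time is exponential in $\ell$ (equivalently, in the number of vertices of $G^4_{3\times\ell}$): there is a constant $c>0$ such that for all sufficiently large odd $\ell$ the mixing time is at least $2^{c\ell}$.
   Context: The bandwidth of a graph $G$ on $n$ vertices is $\min_{\sigma}\max_{u\sim v}|\sigma(u)-\sigma(v)|$, the minimum over bijections $\sigma:V(G)\to\{1,\dots,n\}$, the maximum over adjacent pairs. A contiguous $2$-partition of a graph $G$ is a partition of $V(G)$ into two unordered (not necessarily nonempty) pieces, each inducing a connected subgraph of $G$ (the empty set counts as connected); there is no bound on the piece sizes. Let $\Omega$ be the set of contiguous $2$-partitions of $G$. Glauber dynamics $\mathcal{M}$ on $\Omega$: from $\omega\in\Omega$, (a) choose a uniformly random vertex $v\in V(G)$; (b) choose a uniformly random set among the (distinct) sets in $\omega$; (c) remove $v$ from its current set and make it a member of the chosen set, if the resulting partition belongs to $\Omega$; otherwise remain at $\omega$. The mixing time is the least $t$ such that from every starting state the distribution after $t$ steps is within total variation distance $1/4$ of the stationary distribution. *)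

(* Defs.v *)
From HB Require Import structures.
From mathcomp Require Import all_boot all_order all_algebra.
From mathcomp Require Import classical_sets reals constructive_ereal ereal exp.

Set Implicit Arguments.
Unset Strict Implicit.
Unset Printing Implicit Defensive.

Import Order.TTheory GRing.Theory Num.Theory.
Local Open Scope set_scope.
Local Open Scope nat_scope.

Record sgraph := SGraph {
  vertex :> finType;
  adj : rel vertex;
  adj_sym : symmetric adj;
  adj_irr : irreflexive adj }.

Section Induced.
Variables (G : sgraph) (A : {set G}).

Definition induced_adj : rel {x : G | x \in A} :=
  fun x y => adj (val x) (val y).

Lemma induced_sym : symmetric induced_adj.
Proof. by move=> x y; exact: adj_sym. Qed.

Lemma induced_irr : irreflexive induced_adj.
Proof. by move=> x; exact: adj_irr. Qed.

Definition induced : sgraph := SGraph induced_sym induced_irr.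

End Induced.

(* The graph without vertices is connected in this sense. *)
Definition connected (G : sgraph) : bool :=
  [forall x : G, forall y : G, connect (@adj G) x y].

Definition k_connected (k : nat) (G : sgraph) : Prop :=
  k < #|G| /\ forall S : {set G}, #|S| < k -> connected (induced (~: S)).

(* "Distance at most k" is the existence of a walk with at most k edges. *)
Definition dist_le (G : sgraph) (k : nat) (x y : G) : bool :=
  [exists n : 'I_k.+1, exists p : n.-tuple G,
     path (@adj G) x p && (last x p == y)].

(* An injection from G to 'I_#|G| is a bijection, and numbering the vertices
   from 0 instead of 1 does not change differences. *)
Definition stretch (G : sgraph) (s : {ffun G -> 'I_#|G|}) : nat :=
  \max_(e : G * G | adj e.1 e.2) `|(s e.1 : nat) - (s e.2 : nat)|.

(* The neutral value #|G| never is the minimum when G has a vertex: every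
   numbering has stretch less than #|G|. *)
Definition bandwidth (G : sgraph) : nat :=
  \big[minn/#|G|]_(s : {ffun G -> 'I_#|G|} | injectiveb s) stretch s.

Section Grid.
Variable l : nat.

Definition consecutive (i j : 'I_l) : bool := (i.+1 == j) || (j.+1 == i).

Definition grid_adj : rel ('I_l * 'I_l) := fun x y =>
  ((x.1 == y.1) && consecutive x.2 y.2) ||
  (consecutive x.1 y.1 && (x.2 == y.2)).

Lemma grid_sym : symmetric grid_adj.
Proof.
move=> x y; rewrite /grid_adj /consecutive (eq_sym x.1) (eq_sym x.2).
by rewrite (orbC (x.1.+1 == y.1)) (orbC (x.2.+1 == y.2)).
Qed.

Lemma grid_irr : irreflexive grid_adj.
Proof.
by move=> x; rewrite /grid_adj /consecutive !orbb !(gtn_eqF (ltnSn _)) andbF.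
Qed.

Definition grid : sgraph := SGraph grid_sym grid_irr.

(* For odd l, the middle index among 0, ..., l - 1 is l./2. *)
Definition middle_lines : {set grid} :=
  [set x : grid | (x.1 == l./2 :> nat) || (x.2 == l./2 :> nat)].

Definition cross_vertices : {set grid} :=
  [set x : grid | [exists y in middle_lines, dist_le 1 x y]].

(* The graph G^4_{3 x l}. *)
Definition cross : sgraph := induced cross_vertices.

End Grid.

Local Open Scope ring_scope.

Section MarkovChain.
Variables (R : realType) (T : finType) (P : T -> T -> R).

Definition evolve (mu : {ffun T -> R}) : {ffun T -> R} :=
  [ffun y => \sum_x mu x * P x y].

Definition law (t : nat) (x : T) : {ffun T -> R} :=
  iter t evolve [ffun y => (y == x)%:R].

Definition irreducible : Prop := forall x y, exists t, 0 < law t x y.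

(* The greatest common divisor of the return times to x is 1. *)
Definition aperiodic : Prop :=
  forall x d, (forall t, 0 < law t x x -> (d %| t)%N) -> d = 1%N.

Definition ergodic : Prop := irreducible /\ aperiodic.

Definition stationary (pi : {ffun T -> R}) : Prop :=
  [/\ forall x, 0 <= pi x, \sum_x pi x = 1 & evolve pi = pi].

Definition total_variation (mu nu : {ffun T -> R}) : R :=
  2^-1 * \sum_x `|mu x - nu x|.

(* The least t with the stated property, or +oo when there is none. *)
Definition mixing_time (pi : {ffun T -> R}) : \bar R :=
  ereal_inf [set (t%:R)%:E | t in
    [set t : nat | forall x, total_variation (law t x) pi <= 4^-1]]%classic.

End MarkovChain.

Section Glauber.
Variable G : sgraph.

(* An unordered partition with possibly empty pieces is encoded as the set of
   its two pieces; the one with an empty piece is [set set0; setT]. *)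
Definition contiguous2 (w : {set {set G}}) : bool :=
  [exists A : {set G},
    [&& w == [set A; ~: A], connected (induced A)
      & connected (induced (~: A))]].

Definition Omega : finType := {w : {set {set G}} | contiguous2 w}.

Definition move_vertex (w : {set {set G}}) (v : G) (B : {set G}) :
    {set {set G}} :=
  [set if C == B then v |: C else C :\ v | C in w].

(* insubd w makes the chain stay at w when the move leaves Omega. *)
Definition glauber (R : realType) (w w' : Omega) : R :=
  \sum_(v : G) #|G|%:R^-1 *
    \sum_(B in val w) #|val w|%:R^-1 *
      (insubd w (move_vertex (val w) v B) == w')%:R.

End Glauber.

(* Main.v *)
Require Import Defs.
From mathcomp Require Import all_boot all_order all_algebra.
From mathcomp Require Import classical_sets reals constructive_ereal ereal exp.
From mathcomp Require Import zify ring.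
From mathcomp Require Import fintype finset.
Import Defs.

Import Order.TTheory GRing.Theory Num.Theory.
Local Open Scope ring_scope.

(* Glauber dynamics is a symmetric lazy chain, so its stationary distribution is
   uniform and a bottleneck bounds the mixing time. The states in which both
   horizontal arms contain a transversal line whose two ends lie in different
   pieces form the bottleneck set S, with l = 2m + 1:
   - S and its complement have at least 2^l states each, obtained by cutting the
     cross along its middle row or its middle column and distributing the
     vertices of that line arbitrarily;
   - a step out of S starts at a state where one horizontal arm has a single
     line with ends of different colors. By Euler's relation at most two edges
     of the outer boundary are bichromatic, so the vertical arms have no such
     line, and the middle vertices of the lines with ends of the same color carry
     only O(log m) bits of information per arm. Hence at most poly(m) 2^m states
     of S can leave it. *)

Set Implicit Arguments.
Unset Strict Implicit.
Unset Printing Implicit Defensive.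

(** * Induced connectivity and 2-connected graphs *)

(** Each outer boundary turn of an arm is paid for out of a budget of two. Two connected pieces have
    at least [#|G| - 2] inner edges in all. Deleting the redundant edge of every monochromatic unit
    square leaves a bound that is tight up to this budget. A line with ends of different colors
    forces a turn in its arm, so a state of S, with such a line in both horizontal arms, spends the
    whole budget there.

    A move changes one vertex, and the lines of one arm are disjoint. Hence a move out of S must
    destroy the only such line of some horizontal arm, and that arm keeps a single free middle
    vertex. Only the opposite arm can still have m free middle vertices, against the 2m + 1 free
    vertices that give the lower bound on S. This missing factor of about 2^m is the bottleneck. *)

Section Connectivity.
Local Open Scope set_scope.
Local Open Scope nat_scope.

Lemma connect_homo (T U : finType) (e : rel T) (e' : rel U) (f : T -> U) :
  (forall x y, e x y -> e' (f x) (f y)) ->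
  forall x y, connect e x y -> connect e' (f x) (f y).
Proof.
move=> fe x y /connectP[p + ->] {y}.
elim: p x => [|z p IHp] x //= /andP[/fe xz /IHp]; exact/connect_trans/connect1.
Qed.

Lemma connect_closed (T : finType) (e : rel T) (R : pred T) :
  (forall x y, e x y -> R x -> R y) -> forall x y, connect e x y -> R x -> R y.
Proof.
move=> Re x y /connectP[p + ->] {y}.
by elim: p x => [|z p IHp] x //= /andP[/Re xz /IHp Rz] /xz.
Qed.

Variable G : sgraph.
Implicit Types (A R : {set G}) (u v x y : G).

Definition adj_in A : rel G := [rel x y | [&& x \in A, y \in A & adj x y]].

Lemma adj_inP A x y : x \in A -> y \in A -> adj x y -> connect (adj_in A) x y.
Proof. by move=> xA yA xy; apply: connect1; apply/and3P. Qed.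

Lemma connect_adj_in_sym A : connect_sym (adj_in A).
Proof.
apply: sym_connect_sym => x y; rewrite /adj_in/= adj_sym.
by rewrite andbCA.
Qed.

Lemma connected_inducedP A :
  reflect {in A &, forall x y, connect (adj_in A) x y} (connected (induced A)).
Proof.
apply: (iffP idP) => [cA x y xA yA|cA].
  have /forallP/(_ (Sub x xA))/forallP/(_ (Sub y yA)) := cA.
  move/(@connect_homo _ _ _ (adj_in A) val); apply=> u v uv.
  by apply/and3P; split; [exact: valP | exact: valP | ].
apply/forallP=> x; apply/forallP=> y.
rewrite -[x](valKd x) -[y](valKd x).
apply: (connect_homo _ (cA _ _ (valP x) (valP y))) => u v /and3P[uA vA uv].
by rewrite /adj/= /induced_adj !insubdK.
Qed.

(** Strong induction on [mu]. The vertex [u] only has to be reachable from [v], not adjacent to it,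
    so a descent may make a detour around a deleted vertex. *)
Lemma connected_descent A r (mu : G -> nat) : r \in A ->
  (forall v, v \in A -> v != r ->
     exists u, [/\ u \in A, connect (adj_in A) v u & mu u < mu v]) ->
  connected (induced A).
Proof.
move=> rA desc; have reach v : v \in A -> connect (adj_in A) v r.
  have [n] := ubnP (mu v); elim: n v => // n IHn v lt_v vA.
  have [-> //|/(desc _ vA)[u [uA vu lt_uv]]] := eqVneq v r.
  by apply: connect_trans vu (IHn _ _ uA); apply: leq_trans lt_uv _.
apply/connected_inducedP=> x y /reach xr /reach.
by rewrite connect_adj_in_sym; apply: connect_trans.
Qed.

Lemma connected_closed A R x y : connected (induced A) ->
  {in A &, forall u v, adj u v -> u \in R -> v \in R} ->
  x \in A -> y \in A -> x \in R -> y \in R.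
Proof.
move=> /connected_inducedP cA RA xA yA; move: (cA _ _ xA yA).
by apply: connect_closed => u v /and3P[uA vA uv]; apply: RA.
Qed.

Lemma connected_setU1 A v b : connected (induced A) -> b \in A -> adj v b ->
  connected (induced (v |: A)).
Proof.
move=> /connected_inducedP cA bA vb.
apply: (@connected_descent _ b (fun u => u != b)); first by rewrite !inE bA orbT.
move=> u; rewrite !inE => uA ub; exists b.
rewrite eqxx ub !inE bA orbT; split=> //.
have [->|uv] := eqVneq u v; first by apply: adj_inP; rewrite ?inE ?eqxx ?bA ?orbT.
move: uA; rewrite (negPf uv) /= => uA.
apply: (connect_homo (f := id) _ (cA _ _ uA bA)) => x y /and3P[xA yA xy].
by rewrite /adj_in/= !inE xA yA xy !orbT.
Qed.

Lemma connected_set0 : connected (induced (set0 : {set G})).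
Proof. by apply/connected_inducedP=> x y; rewrite inE. Qed.

Hypothesis G2 : k_connected 2 G.

Lemma biconnected_setC1 (c : G) : connected (induced (~: [set c])).
Proof. by apply: G2.2; rewrite cards1. Qed.

Lemma biconnected_setT : connected (induced (setT : {set G})).
Proof. by rewrite -setC0; apply: G2.2; rewrite cards0. Qed.

(* Among all components C of A minus a vertex c, take one of least size. As c
   does not separate G, some v in C has a neighbour outside A; a component of
   A minus v that misses c would be a proper subset of C. *)
Lemma biconnected_peel A : connected (induced A) -> connected (induced (~: A)) ->
  A != set0 -> A != setT ->
  exists2 v, v \in A
    & connected (induced (A :\ v)) /\ connected (induced (v |: ~: A)).
Proof.
move=> cA cB A0 AT.
have [b bA] : exists b, b \in ~: A.
  by apply/set0Pn; apply: contraNneq AT => eA; rewrite -[A]setCK eA setC0.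
have bA' : b \notin A by rewrite -in_setC.
have [|A_gt1] := leqP #|A| 1.
  rewrite leq_eqVlt ltnS leqn0 cards_eq0 (negPf A0) orbF => /cards1P[v Av].
  exists v; first by rewrite Av set11.
  by rewrite Av setDv setUCr; split; [apply: connected_set0|apply: biconnected_setT].
pose C (p : G * G) := [set y | connect (adj_in (A :\ p.1)) p.2 y].
pose P p := [&& p.1 \in A, p.2 \in A & p.2 != p.1].
have [p0 Pp0] : exists p, P p.
  have /card_gt1P[x [y [xA yA xy]]] := A_gt1.
  by exists (x, y); rewrite /P xA yA eq_sym.
case: (arg_minnP (fun p => #|C p|) Pp0) => -[c u] /and3P[/= cA' uA uc] minC.
have CA p : P p -> C p \subset A :\ p.1.
  move=> /and3P[pA qA qp]; apply/subsetP=> y; rewrite inE => py.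
  have p1A : p.2 \in A :\ p.1 by rewrite !inE qp.
  by apply: (connect_closed (R := mem (A :\ p.1)) _ py) => // x z /and3P[].
have Ccl p x y : x \in C p -> x \in A :\ p.1 -> y \in A :\ p.1 -> adj x y -> y \in C p.
  by rewrite !inE => px *; apply: connect_trans px _; apply: adj_inP; rewrite ?inE.
have PCcu : P (c, u) by apply/and3P.
have uC : u \in C (c, u) by rewrite inE connect0.
(* Without an edge from [C (c, u)] to the outside of [A], this component would be closed in the
   connected graph G minus [c], and would contain [b]. *)
have [/existsP[v /existsP[w /and3P[vC wA vw]]]|noedge] :=
  boolP [exists v, exists w, [&& v \in C (c, u), w \notin A & adj v w]]; last first.
  have : b \in C (c, u).
    apply: (connected_closed (biconnected_setC1 c) _ _ _ uC).
    - move=> x y; rewrite !inE => xc yc xy xC.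
      have yA : y \in A.
        apply: contraNT noedge => yA; apply/existsP; exists x.
        by apply/existsP; exists y; rewrite !inE xC yA.
      have xCs : x \in C (c, u) by rewrite inE.
      suff : y \in C (c, u) by rewrite inE.
      apply: (Ccl _ x) => //; first exact: (subsetP (CA _ PCcu)).
      by rewrite !inE yc.
    - by rewrite !inE.
    - by rewrite !inE; apply: contraNneq bA' => ->.
  by move/(subsetP (CA _ PCcu)); rewrite !inE (negPf bA') andbF.
have := subsetP (CA _ PCcu) _ vC; rewrite !inE /= => /andP[vc vA].
exists v => //; split; last by apply: (connected_setU1 cB) vw; rewrite inE.
apply: (@connected_descent _ c (fun y => y != c)).
  by rewrite !inE eq_sym vc.
move=> y; rewrite !inE => /andP[yv yA] yc; exists c.
rewrite !inE eqxx yc eq_sym vc cA'; split => //.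
apply: contraT => cy.
have PCvy : P (v, y) by apply/and3P.
have yD : y \in C (v, y) by rewrite inE connect0.
have cD : c \notin C (v, y) by rewrite inE.
(* [A] is connected and the component of [y] misses [c], so it can be left only through [v]. *)
have [d dD dv] : exists2 d, d \in C (v, y) & adj d v.
  apply/exists_inP; apply: contraNT cD => noedge'.
  apply: (connected_closed cA _ yA cA' yD) => x z xA zA xz xD.
  apply: (Ccl _ x) => //; first exact: (subsetP (CA _ PCvy)).
  rewrite !inE zA andbT; apply: contraNneq noedge' => /= zv.
  by apply/exists_inP; exists x => //; rewrite -zv.
have dAv := subsetP (CA _ PCvy) _ dD.
have /andP[dv' dA] : (d != v) && (d \in A) by move: dAv; rewrite !inE.
have dc : d != c by apply: contraNneq cD => <-.
have dC : d \in C (c, u).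
  apply: (Ccl _ v) => //; rewrite ?inE ?vc ?vA ?dc ?dA //.
  by rewrite adj_sym.
have sDC : C (v, y) \subset C (c, u) :\ v.
  apply/subsetP=> z zD.
  have dz : connect (adj_in (A :\ v)) d z.
    move: dD zD; rewrite !inE => yd yz.
    by apply: connect_trans yz; rewrite connect_adj_in_sym.
  have: (z \in C (v, y)) && (z \in C (c, u)).
    apply: (connect_closed (R := fun z => (z \in C (v, y)) && (z \in C (c, u))) _ dz).
      move=> x w' /and3P[xA wA' xw] /andP[xD xC].
      have wD : w' \in C (v, y) by apply: (Ccl _ x).
      rewrite wD; apply: (Ccl _ x) => //; first exact: (subsetP (CA _ PCcu)).
      have := wA'; rewrite !inE => /andP[_ ->]; rewrite andbT.
      by apply: contraNneq cD => /= <-.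
    by rewrite dD dC.
  case/andP=> _ zC; rewrite in_setD1 zC andbT.
  by have := subsetP (CA _ PCvy) _ zD; rewrite !inE => /andP[].
have := leq_trans (minC _ PCvy) (subset_leq_card sDC).
by rewrite [X in X <= _](cardsD1 v) vC ltnn.
Qed.

End Connectivity.

(** * Symmetric Markov chains *)

Section SymmetricChain.
Variables (R : realType) (T : finType) (P : T -> T -> R).
Hypothesis P_ge0 : forall x y, 0 <= P x y.
Hypothesis P_sum1 : forall x, \sum_y P x y = 1.
Hypothesis P_sym : forall x y, P x y = P y x.

Local Notation law := (law P).

Lemma law0 x y : law 0 x y = (y == x)%:R.
Proof. by rewrite /Defs.law ffunE. Qed.

Lemma lawS t x y : law t.+1 x y = \sum_z law t x z * P z y.
Proof. by rewrite /Defs.law iterS ffunE. Qed.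

Lemma law_ge0 t x y : 0 <= law t x y.
Proof.
elim: t y => [|t IHt] y; first by rewrite law0 ler0n.
by rewrite lawS sumr_ge0 // => z _; rewrite mulr_ge0.
Qed.

Lemma law_suml t y : \sum_x law t x y = 1.
Proof.
elim: t y => [|t IHt] y.
  under eq_bigr do rewrite law0; rewrite (bigD1 y) //= eqxx big1 ?addr0 // => x.
  by rewrite eq_sym => /negPf->.
under eq_bigr do rewrite lawS.
rewrite exchange_big /=; under eq_bigr do rewrite -mulr_suml IHt mul1r P_sym.
exact: P_sum1.
Qed.

Lemma law_sumr t x : \sum_y law t x y = 1.
Proof.
elim: t => [|t IHt].
  under eq_bigr do rewrite law0; rewrite (bigD1 x) //= eqxx big1 ?addr0 // => y.
  by move=> /negPf->.
under eq_bigr do rewrite lawS.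
by rewrite exchange_big /=; under eq_bigr do rewrite -mulr_sumr P_sum1 mulr1.
Qed.

Lemma connect_law_gt0 x y :
  connect (fun u v => 0 < P u v) x y -> exists t, 0 < law t x y.
Proof.
case/connectP=> p + ->{y}; elim/last_ind: p => [|p z IHp] /=.
  by exists 0%N; rewrite law0 eqxx.
rewrite rcons_path last_rcons => /andP[/IHp[t t_gt0] pz]; exists t.+1.
rewrite lawS (bigD1 (last x p)) //= ltr_pwDl ?mulr_gt0 //.
by rewrite sumr_ge0 // => u _; rewrite mulr_ge0 // law_ge0.
Qed.

Lemma irreducible_ergodic : (forall x, 0 < P x x) -> irreducible P -> ergodic P.
Proof.
move=> Pxx irr; split=> // x d /(_ 1%N) d1; apply/eqP; rewrite -dvdn1; apply: d1.
rewrite lawS (bigD1 x) //= law0 eqxx mul1r ltr_pwDl //.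
by rewrite sumr_ge0 // => u _; rewrite mulr_ge0 // law0 ler0n.
Qed.

Lemma iter_evolve t (mu : {ffun T -> R}) y :
  iter t (evolve P) mu y = \sum_x mu x * law t x y.
Proof.
elim: t y => [|t IHt] y.
  rewrite (bigD1 y) //= law0 eqxx mulr1 big1 ?addr0 // => x.
  by rewrite law0 eq_sym => /negPf->; rewrite mulr0.
rewrite iterS ffunE; under eq_bigr do rewrite IHt mulr_suml.
rewrite exchange_big; apply: eq_bigr => x _.
by rewrite lawS mulr_sumr; apply: eq_bigr => z _; rewrite mulrA.
Qed.

Definition uniform : {ffun T -> R} := [ffun=> #|T|%:R^-1].

Lemma uniform_stationary : (0 < #|T|)%N -> stationary P uniform.
Proof.
move=> T_gt0; have T_neq0 : #|T|%:R != 0 :> R by rewrite pnatr_eq0 -lt0n.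
split.
- by move=> x; rewrite ffunE invr_ge0 ler0n.
- under eq_bigr do rewrite ffunE.
  by rewrite sumr_const -[LHS]mulr_natr mulVf.
apply/ffunP=> y; rewrite !ffunE; under eq_bigr do rewrite ffunE P_sym.
by rewrite -mulr_sumr P_sum1 mulr1.
Qed.

(* Maximum principle, as the columns of the transition matrix also sum to 1. *)
Lemma stationary_uniform (mu : {ffun T -> R}) :
  irreducible P -> stationary P mu -> mu = uniform.
Proof.
move=> irr [mu_ge0 mu_sum1 mu_fix].
have [x0 _] : exists x0 : T, true.
  apply/existsP; apply: contraT; rewrite negb_exists => /forallP T0.
  by have := oner_neq0 R; rewrite -mu_sum1 big1 ?eqxx // => x; have := T0 x.
have [y0 _ max_y0] := @Order.TotalTheory.arg_maxP _ R T x0 predT mu isT.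
have {}max_y0 x : mu x <= mu y0 by apply: max_y0.
have mu_law t y : mu y = \sum_x mu x * law t x y.
  by rewrite -iter_evolve iter_fix.
have mu_const x : mu x = mu y0.
  have [t t_gt0] := irr x y0.
  apply/eqP; rewrite eq_le max_y0 //= leNgt; apply/negP=> lt_x.
  have := mu_law t y0; apply/eqP; rewrite gt_eqF //.
  rewrite -[ltRHS]mulr1 -(law_suml t y0) mulr_sumr.
  rewrite (bigD1 x) //= [ltRHS](bigD1 x) //= ltr_leD ?ltr_pM2r //.
  by apply: ler_sum => z _; rewrite ler_wpM2r ?law_ge0 ?max_y0.
apply/ffunP=> x; rewrite ffunE mu_const.
have muT : #|T|%:R * mu y0 = 1.
  rewrite -[RHS]mu_sum1; under [RHS]eq_bigr do rewrite mu_const.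
  by rewrite sumr_const mulr_natl.
have T_neq0 : #|T|%:R != 0 :> R.
  by apply/eqP=> T0; move: muT; rewrite T0 mul0r => /esym/eqP; rewrite oner_eq0.
by rewrite -[LHS](mulKf T_neq0) muT mulr1.
Qed.

(** Under the uniform distribution this is [#|T|] times the stationary probability of a step from
    [S] to its complement. *)
Definition flow (S : {set T}) : R := \sum_(x in S) \sum_(y in ~: S) P x y.

Lemma flowC (S : {set T}) : flow (~: S) = flow S.
Proof.
rewrite /flow setCK exchange_big /=; apply: eq_bigr => x _.
by apply: eq_bigr => y _; rewrite P_sym.
Qed.

(** This is [#|S|] times the probability of being outside [S] at time [t] after a uniform start in
    [S]. *)
Definition escaped (S : {set T}) t : R :=
  \sum_(x in S) \sum_(y in ~: S) law t x y.

(** Split by the state at time [t]. States outside [S] account for [escaped S t]; a state [z] in [S]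
    is reached with total weight at most 1 over all starts, because columns of [law] sum to 1, so
    these states account for at most [flow S]. *)
Lemma escapedS (S : {set T}) t : escaped S t.+1 <= escaped S t + flow S.
Proof.
have le_part (Q : pred T) z : \sum_(y | Q y) P z y <= 1.
  by rewrite -(P_sum1 z) [leRHS](bigID Q) /= ler_wpDr // sumr_ge0.
pose A z := \sum_(y in ~: S) P z y.
have A_ge0 z : 0 <= A z by rewrite sumr_ge0.
have -> : escaped S t.+1 = \sum_(x in S) \sum_z law t x z * A z.
  apply: eq_bigr => x _; under eq_bigr do rewrite lawS.
  by rewrite exchange_big /=; apply: eq_bigr => z _; rewrite mulr_sumr.
under eq_bigr do rewrite (bigID (mem (~: S))) /=.
rewrite big_split /= lerD //.
  apply: ler_sum => x _; apply: ler_sum => z _.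
  by rewrite ler_piMr ?law_ge0 ?le_part.
rewrite exchange_big /=.
under [leLHS]eq_bigl do rewrite in_setC negbK.
apply: ler_sum => z _; rewrite -mulr_suml ler_piMl //.
rewrite -(law_suml t z) [leRHS](bigID (mem S)) /= ler_wpDr // sumr_ge0 // => x _.
exact: law_ge0.
Qed.

Lemma escaped_le (S : {set T}) t : escaped S t <= t%:R * flow S.
Proof.
elim: t => [|t IHt]; last first.
  apply: le_trans (escapedS _ _) _; rewrite -(natr1 t) mulrDl mul1r.
  exact: lerD IHt _.
rewrite mul0r /escaped big1 // => x xS; rewrite big1 // => y; rewrite inE law0.
by case: eqVneq => // ->; rewrite xS.
Qed.

Lemma sum_le_total_variation (mu nu : {ffun T -> R}) (B : {set T}) :
  \sum_x mu x = \sum_x nu x ->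
  \sum_(x in B) mu x - \sum_(x in B) nu x <= total_variation mu nu.
Proof.
move=> eq_sum; rewrite /total_variation -sumrB.
have B0 : \sum_(x in B) (mu x - nu x) = - \sum_(x in ~: B) (mu x - nu x).
  apply/eqP; rewrite -subr_eq0 opprK; apply/eqP.
  transitivity (\sum_x (mu x - nu x)); last by rewrite sumrB eq_sum subrr.
  rewrite [RHS](bigID (mem B)) /=; congr (_ + _).
  by apply: eq_bigl => x; rewrite in_setC.
rewrite ler_pdivlMl // mulr_natl mulr2n {2}B0 -sumrN [leRHS](bigID (mem B)) /=.
apply: lerD; first by apply: ler_sum => x _; apply: ler_norm.
under [leLHS]eq_bigl do rewrite in_setC.
by apply: ler_sum => x _; rewrite -normrN ler_norm.
Qed.

(** The complement has uniform mass at least 1/2, so from every start in [S] a mixed chain is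
    outside [S] with probability at least 1/2 - 1/4. Summing over the starts gives [#|S| / 4], to be
    compared with [escaped_le]. *)
Lemma half_set_mixing (S : {set T}) t :
  (#|S|.*2 <= #|T|)%N ->
  (forall x, total_variation (law t x) uniform <= 4^-1) ->
  #|S|%:R <= 4 * t%:R * flow S.
Proof.
move=> S_le mix; rewrite -mulrA -ler_pdivrMl //.
apply: le_trans (escaped_le S t).
rewrite -sum1_card natr_sum mulr_sumr; apply: ler_sum => x xS; rewrite mulr1.
have T_gt0 : (0 < #|T|)%N by apply/card_gt0P; exists x.
have T_neq0 : #|T|%:R != 0 :> R by rewrite pnatr_eq0 -lt0n.
have [_ U1 _] := uniform_stationary T_gt0.
have : \sum_(y in ~: S) uniform y - \sum_(y in ~: S) law t x y <= 4^-1.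
  apply: le_trans (mix x); rewrite [leRHS]/total_variation.
  under [X in _ <= _ * X]eq_bigr do rewrite distrC.
  apply: sum_le_total_variation; rewrite law_sumr; exact: U1.
rewrite lerBlDr -lerBlDl; apply: le_trans.
under eq_bigr do rewrite ffunE.
rewrite sumr_const cardsCs setCK -[X in X - _]mulr_natl lerBrDl.
have -> : 4^-1 + 4^-1 = 2^-1 :> R by field.
rewrite ler_pdivlMr ?ltr0n // ler_pdivrMl // -natrM ler_nat.
rewrite mul2n doubleB -[leqLHS](addnK #|T|) addnn.
exact: leq_sub2l.
Qed.

(** One of [S] and its complement has at most half of the states, and both have the same flow by
    symmetry. *)
Lemma bottleneck_mixing (S : {set T}) (N : nat) (K : R) t :
  (N <= #|S|)%N -> (N <= #|~: S|)%N -> flow S <= K ->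
  (forall x, total_variation (law t x) uniform <= 4^-1) ->
  N%:R <= 4 * t%:R * K.
Proof.
move=> NS NSC leK mix.
suff [S' NS' [le_S' leK']] : exists2 S' : {set T},
    (N <= #|S'|)%N & (#|S'|.*2 <= #|T|)%N /\ flow S' <= K.
  apply: le_trans (_ : #|S'|%:R <= _); first by rewrite ler_nat.
  apply: le_trans (half_set_mixing le_S' mix) _.
  by rewrite ler_wpM2l // mulr_ge0.
have [le_S|/ltnW lt_S] := leqP #|S|.*2 #|T|; first by exists S.
exists (~: S) => //; rewrite flowC; split=> //.
by rewrite cardsCs setCK doubleB leq_subLR -addnn leq_add2r.
Qed.

Lemma mixing_time_ge (S : {set T}) (N : nat) (K B : R) :
  (N <= #|S|)%N -> (N <= #|~: S|)%N -> flow S <= K ->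
  (forall t : nat, N%:R <= 4 * t%:R * K -> B <= t%:R) ->
  (B%:E <= mixing_time P uniform)%E.
Proof.
move=> NS NSC leK leB; apply: le_ereal_inf_tmp => _ [t /= mix <-].
by rewrite lee_fin; apply/leB/(bottleneck_mixing NS NSC leK).
Qed.

End SymmetricChain.

(** * Glauber dynamics *)

Section GlauberChain.
Local Open Scope set_scope.
Variables (R : realType) (G : sgraph).
Implicit Types (A B : {set G}) (v : G) (w : Omega G).

(** Symmetric difference with [[set v]]. It commutes with complement, so it acts on an unordered
    pair of pieces without a choice of one of them. *)
Definition toggle A v : {set G} := if v \in A then A :\ v else v |: A.

Definition flip (W : {set {set G}}) v : {set {set G}} :=
  [set toggle A v | A in W].

Lemma in_toggle A v x : (x \in toggle A v) = (x == v) (+) (x \in A).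
Proof.
rewrite /toggle; case: ifPn => vA; rewrite !inE.
  by case: eqVneq => // ->; rewrite vA.
by case: eqVneq => // ->; rewrite (negPf vA).
Qed.

Lemma toggleK A v : toggle (toggle A v) v = A.
Proof. by apply/setP=> x; rewrite !in_toggle addKb. Qed.

Lemma toggleC A v : toggle (~: A) v = ~: toggle A v.
Proof. by apply/setP=> x; rewrite in_toggle !inE in_toggle addbN. Qed.

Lemma flip_set2 A v : flip [set A; ~: A] v = [set toggle A v; ~: toggle A v].
Proof. by rewrite /flip imsetU1 imset_set1 toggleC. Qed.

Lemma flipK W v : flip (flip W v) v = W.
Proof.
rewrite /flip -imset_comp -[RHS]imset_id; apply: eq_imset => A /=.
exact: toggleK.
Qed.

Lemma setC_pair A : [set A; ~: A] = [set ~: A; ~: ~: A].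
Proof. by rewrite setCK setUC. Qed.

Lemma OmegaP w : exists A,
  [/\ val w = [set A; ~: A], connected (induced A) & connected (induced (~: A))].
Proof. by have /existsP[A /and3P[/eqP]] := valP w; exists A. Qed.

Lemma OmegaP_at w v : exists2 A : {set G}, v \in A &
  [/\ val w = [set A; ~: A], connected (induced A) & connected (induced (~: A))].
Proof.
have [A [wA cA cB]] := OmegaP w.
have [vA|vA] := boolP (v \in A); first by exists A.
by exists (~: A); rewrite ?inE // setCK -[X in [set _; X]]setCK -setC_pair.
Qed.

Lemma contiguous2_pair A :
  connected (induced A) -> connected (induced (~: A)) ->
  contiguous2 [set A; ~: A].
Proof. by move=> cA cB; apply/existsP; exists A; rewrite eqxx cA cB. Qed.

(** Choosing the piece that already contains [v] changes nothing; choosing the other piece toggles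
    [v] in both. *)
Lemma move_vertexE A v B : A != ~: A -> B \in [set A; ~: A] ->
  move_vertex [set A; ~: A] v B =
    if v \in B then [set A; ~: A] else flip [set A; ~: A] v.
Proof.
move=> AC BA; wlog -> : A AC BA / B = A => [IH|].
  have := BA; rewrite !inE => /orP[/eqP|/eqP e]; first exact: IH.
  by rewrite setC_pair; apply: IH; rewrite -?setC_pair // setCK eq_sym.
rewrite flip_set2 /move_vertex imsetU1 imset_set1 eqxx eq_sym (negPf AC) /toggle.
case: ifPn => vA; last by rewrite (negPf vA) setCU setDE setIC.
have /setUidPr vA' : [set v] \subset A by rewrite sub1set.
by rewrite setDE -setCU (setUC A) vA'.
Qed.

Lemma set_pair_neq A v : A != ~: A.
Proof.
by apply/eqP=> /setP/(_ v); rewrite inE; case: (v \in A).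
Qed.

(** For each [v] the chain holds with probability 1/2 and proposes the flip at [v] otherwise.
    Laziness gives aperiodicity, and symmetry follows because [flip] is an involution. *)
Lemma glauberE w w' : glauber R w w' =
  \sum_v #|G|%:R^-1 * (2^-1 *
    ((w == w')%:R + (insubd w (flip (val w) v) == w')%:R)).
Proof.
apply: eq_bigr => v _; congr (_ * _).
have [A vA [wA _ _]] := OmegaP_at w v; have AC := set_pair_neq A v.
rewrite -mulr_sumr wA cards2 AC; congr (_ * _).
by rewrite big_setU1 ?inE //= big_set1 !move_vertexE ?set21 ?set22 // inE vA -wA valKd.
Qed.

Lemma glauber_ge0 w w' : 0 <= glauber R w w'.
Proof.
by rewrite glauberE sumr_ge0 // => v _; rewrite !mulr_ge0 ?invr_ge0 ?addr_ge0 ?ler0n.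
Qed.

Lemma glauber_sym w w' : glauber R w w' = glauber R w' w.
Proof.
have [-> //|ww'] := eqVneq w w'.
rewrite !glauberE; apply: eq_bigr => v _; rewrite (eq_sym w').
congr (_ * (_ * (_ + (nat_of_bool _)%:R))).
(* For distinct states, a rejected flip makes [insubd] return [u], which is not [u']; so [u'] is
   reached exactly when it is the flip itself. *)
have flipE u u' : u != u' ->
    (insubd u (flip (val u) v) == u') = (flip (val u) v == val u').
  move=> uu'; rewrite -val_eqE val_insubd; case: ifP => // Fu.
  rewrite val_eqE (negPf uu'); apply/esym/negbTE; apply: contraFneq Fu => ->.
  exact: valP.
rewrite flipE // flipE; last by rewrite eq_sym.
by apply/idP/idP=> /eqP<-; rewrite flipK.
Qed.

Hypothesis G_gt0 : (0 < #|G|)%N.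

Lemma sum_inv_card (a : R) : \sum_(v : G) #|G|%:R^-1 * a = a.
Proof.
rewrite sumr_const -mulrnAl -[_ *+ _]mulr_natr mulVf ?mul1r //.
by rewrite pnatr_eq0 -lt0n.
Qed.

Lemma glauber_sum1 w : \sum_w' glauber R w w' = 1.
Proof.
have delta (u : Omega G) : \sum_u' (u == u')%:R = 1 :> R.
  by rewrite (bigD1 u) //= eqxx big1 ?addr0 // => x; rewrite eq_sym => /negPf->.
under eq_bigr do rewrite glauberE.
rewrite exchange_big /= -[RHS](sum_inv_card 1); apply: eq_bigr => v _.
rewrite -mulr_sumr -mulr_sumr big_split /= !delta -[1 + 1]/(2%:R) mulVf //.
Qed.

Lemma glauber_diag w : 0 < glauber R w w.
Proof.
apply: (@lt_le_trans _ _ 2^-1); first by rewrite invr_gt0 ltr0n.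
rewrite glauberE -[leLHS]sum_inv_card; apply: ler_sum => v _.
by rewrite ler_wpM2l ?invr_ge0 // ler_peMr ?invr_ge0 // eqxx lerDl.
Qed.

Lemma glauber_gt0_flip w w' v : flip (val w) v = val w' -> 0 < glauber R w w'.
Proof.
move=> ww'; rewrite glauberE (bigD1 v) //= ltr_pwDl //.
  rewrite !mulr_gt0 ?invr_gt0 ?ltr0n //.
  by rewrite ww' valKd eqxx ltr_wpDl // ler0n.
by rewrite sumr_ge0 // => u _; rewrite !mulr_ge0 ?invr_ge0 ?addr_ge0 ?ler0n.
Qed.

Lemma glauber_neq w w' : 0 < glauber R w w' -> w != w' ->
  exists v, flip (val w) v = val w'.
Proof.
move=> P_gt0 /negPf ww'.
have [/existsP[v /eqP ?]|] := boolP [exists v, flip (val w) v == val w'].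
  by exists v.
rewrite negb_exists => /forallP noflip; move: P_gt0.
rewrite glauberE big1 ?ltxx // => v _; rewrite ww' add0r.
have -> : (insubd w (flip (val w) v) == w') = false.
  rewrite -val_eqE val_insubd; case: ifP => _; first exact: negbTE (noflip v).
  by rewrite val_eqE.
by rewrite !mulr0.
Qed.

Hypothesis G2 : k_connected 2 G.

Definition trivial_partition : Omega G :=
  Sub [set set0; ~: set0] (contiguous2_pair (connected_set0 G)
    (eq_ind_r (fun A => connected (induced A)) (biconnected_setT G2) (setC0 _))).

Let step w w' := 0 < glauber R w w'.

(** Peel the vertices of one piece off one at a time; [biconnected_peel] keeps both pieces connected
    along the way. *)
Lemma connect_trivial w : connect step w trivial_partition.
Proof.
have [A [wA cA cB]] := OmegaP w.
have [n] := ubnP #|A|; elim: n A w wA cA cB => // n IHn A w wA cA cB leA.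
have [A0|A0] := eqVneq A set0.
  by have -> : w = trivial_partition by apply: val_inj; rewrite wA A0.
have [AT|AT] := eqVneq A setT.
  have -> // : w = trivial_partition.
  by apply: val_inj; rewrite wA AT /= setC0 setCT setUC.
have [v vA [cA' cB']] := biconnected_peel G2 cA cB A0 AT.
have eB : v |: ~: A = ~: (A :\ v).
  by rewrite setCD setUC.
rewrite eB in cB'.
pose w' : Omega G := Sub _ (contiguous2_pair cA' cB').
apply: (@connect_trans _ _ w').
  apply/connect1/(@glauber_gt0_flip _ _ v).
  by rewrite wA flip_set2 /= /toggle vA.
apply: (IHn (A :\ v)) => //.
by move: leA; rewrite (cardsD1 v) vA ltnS.
Qed.

Lemma glauber_irreducible : irreducible (@glauber G R).
Proof.
move=> w w'; apply: connect_law_gt0; first exact: glauber_ge0.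
apply: connect_trans (connect_trivial w) _.
rewrite sym_connect_sym; first exact: connect_trivial.
by move=> u u'; rewrite /step glauber_sym.
Qed.

Lemma glauber_ergodic : ergodic (@glauber G R).
Proof.
apply: irreducible_ergodic; first exact: glauber_ge0.
  exact: glauber_diag.
exact: glauber_irreducible.
Qed.

Lemma Omega_gt0 : (0 < #|{: Omega G}|)%N.
Proof. by apply/card_gt0P; exists trivial_partition. Qed.

Lemma glauber_unique_stationary :
  unique (stationary (@glauber G R)) (uniform R (Omega G)).
Proof.
split=> [|mu st].
  exact: uniform_stationary glauber_sum1 glauber_sym Omega_gt0.
by rewrite (stationary_uniform glauber_ge0 glauber_sum1 glauber_sym
  glauber_irreducible st).
Qed.

(** Only rows of states in [B] contribute to the flow, and each row sums to 1. *)
Lemma glauber_flow_le (S B : {set Omega G}) :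
  (forall w w' v, w \in S -> w' \notin S -> flip (val w) v = val w' -> w \in B) ->
  flow (@glauber G R) S <= #|B|%:R.
Proof.
move=> leB.
rewrite /flow (big_setID B) /= [X in _ + X]big1 ?addr0; last first.
  move=> w; rewrite inE => /andP[wB wS]; rewrite big1 // => w'; rewrite inE => w'S.
  apply/eqP; rewrite eq_le glauber_ge0 andbT leNgt; apply: contra wB => P_gt0.
  have [|v wv] := glauber_neq P_gt0; last exact: leB wv.
  by apply: contraNneq w'S => <-.
rewrite -sum1_card natr_sum [leRHS](big_setID S) /= setIC.
rewrite ler_wpDr ?sumr_ge0 //; apply: ler_sum => w _.
rewrite -[leRHS](glauber_sum1 w).
rewrite [leRHS](bigID (mem (~: S))) /= ler_wpDr // sumr_ge0 // => w' _.
exact: glauber_ge0.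
Qed.

End GlauberChain.

(** * The cross: coordinates, bandwidth, connectivity *)

Section CrossCoordinates.
Local Open Scope set_scope.
Local Open Scope nat_scope.
Variable m : nat.
Hypothesis m_gt0 : 0 < m.

Local Notation l := m.*2.+1.
Local Notation G := (cross l).

Definition in_cross x y :=
  [&& x <= m.*2, y <= m.*2 & (m <= x.+1) && (x <= m.+1) || (m <= y.+1) && (y <= m.+1)].

Lemma half_l : l./2 = m. Proof. exact: half_bit_double m true. Qed.

Lemma dist_le1P (H : sgraph) (x y : H) : reflect (x = y \/ adj x y) (dist_le 1 x y).
Proof.
apply: (iffP existsP) => [[[[|[|//]] ltn] /existsP[p /andP[]]]|[->|xy]].
- by rewrite (tuple0 p) => _ /eqP; left.
- by case/tupleP: p => z p; rewrite (tuple0 p) /= andbT => xz /eqP<-; right.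
- by exists ord0; apply/existsP; exists [tuple]; rewrite /= eqxx.
by exists (Ordinal (ltnSn 1)); apply/existsP; exists [tuple y]; rewrite /= xy eqxx.
Qed.

Lemma cross_verticesE (p : grid l) :
  (p \in cross_vertices l) = in_cross (p.1 : 'I_l) (p.2 : 'I_l).
Proof.
case: p => -[x lx] [y ly]; rewrite inE /in_cross /=.
have lt_m : m < l by lia.
apply/exists_inP/idP.
  case=> -[[x' lx'] [y' ly']]; rewrite inE half_l /= => q_mid /dist_le1P[|].
    by case=> ex ey; move: q_mid; rewrite -ex -ey; lia.
  by rewrite /adj /= /grid_adj /consecutive -!val_eqE /=; lia.
case/and3P=> _ _ mid.
have cand (q : grid l) : (q.1 == m :> nat) || (q.2 == m :> nat) ->
    (Ordinal lx, Ordinal ly) = q \/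
    adj (s := grid l) (Ordinal lx, Ordinal ly) q ->
    exists2 q, q \in middle_lines l
      & dist_le 1 ((Ordinal lx, Ordinal ly) : grid l) q.
  by move=> qM pq; exists q; [rewrite inE half_l | apply/dist_le1P].
have [xm|xm] := eqVneq x m; first by apply: cand (or_introl erefl); rewrite /= xm eqxx.
have [ym|ym] := eqVneq y m.
  by apply: cand (or_introl erefl); rewrite /= ym eqxx orbT.
case/orP: mid => [xM|yM].
  apply: (cand (Ordinal lt_m, Ordinal ly)); rewrite /= ?eqxx //; right.
  by rewrite /adj /= /grid_adj /consecutive -!val_eqE /= eqxx; lia.
apply: (cand (Ordinal lx, Ordinal lt_m)); rewrite /= ?eqxx ?orbT //; right.
by rewrite /adj /= /grid_adj /consecutive -!val_eqE /= eqxx; lia.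
Qed.

Definition px (v : G) : nat := (val v).1.
Definition py (v : G) : nat := (val v).2.

Lemma in_crossP v : in_cross (px v) (py v).
Proof. by rewrite /px /py -cross_verticesE (valP v). Qed.

Lemma pxy_inj u v : px u = px v -> py u = py v -> u = v.
Proof.
move=> xuv yuv; apply: val_inj; rewrite [LHS]surjective_pairing.
by rewrite [RHS]surjective_pairing; congr (_, _); apply: val_inj.
Qed.

Lemma cross_adjE u v : adj u v =
  (px u == px v) && (((py u).+1 == py v) || ((py v).+1 == py u)) ||
  (((px u).+1 == px v) || ((px v).+1 == px u)) && (py u == py v).
Proof. by []. Qed.

Lemma center_subproof : (inord m, inord m) \in cross_vertices l.
Proof. by rewrite cross_verticesE /= inordK /in_cross; lia. Qed.

Definition center : G := Sub (inord m, inord m) center_subproof.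

(* Outside the cross [vtx] takes the junk value [center]. *)
Definition vtx x y : G := insubd center (inord x, inord y).

Lemma px_vtx x y : in_cross x y -> px (vtx x y) = x.
Proof.
move=> xy; have [lx ly] : x < l /\ y < l by move: xy; rewrite /in_cross; lia.
by rewrite /px /vtx insubdK ?inordK // -topredE /= cross_verticesE /= !inordK.
Qed.

Lemma py_vtx x y : in_cross x y -> py (vtx x y) = y.
Proof.
move=> xy; have [lx ly] : x < l /\ y < l by move: xy; rewrite /in_cross; lia.
by rewrite /py /vtx insubdK ?inordK // -topredE /= cross_verticesE /= !inordK.
Qed.

Lemma vtxK v : vtx (px v) (py v) = v.
Proof. by apply: pxy_inj; rewrite (px_vtx, py_vtx) // in_crossP. Qed.

Lemma vtx_inj x y x' y' : in_cross x y -> in_cross x' y' ->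
  vtx x y = vtx x' y' -> x = x' /\ y = y'.
Proof.
by move=> xy xy' e; split; [rewrite -(px_vtx xy) e px_vtx | rewrite -(py_vtx xy) e py_vtx].
Qed.

End CrossCoordinates.

Section Bandwidth.
Local Open Scope set_scope.
Local Open Scope nat_scope.

Lemma bigmin_leq (I : eqType) (r : seq I) (P : pred I) (F : I -> nat) x i :
  i \in r -> P i -> \big[minn/x]_(j <- r | P j) F j <= F i.
Proof.
move=> + Pi; elim: r => //= j r IHr; rewrite inE big_cons.
case/orP=> [/eqP<-|/IHr le_r]; first by rewrite Pi geq_minl.
by case: ifP => // _; apply: leq_trans (geq_minr _ _) le_r.
Qed.

(** Number each vertex by how many vertices have a smaller key. As keys are distinct integers, ranks
    differ by at most as much as keys do, so gaps between the keys are harmless. *)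
Lemma bandwidth_leq (G : sgraph) (key : G -> nat) b :
  injective key -> (forall u v, adj u v -> key u <= key v + b) ->
  bandwidth G <= b.
Proof.
move=> key_inj key_adj.
pose below v := [set w | key w < key v].
have below_lt v : #|below v| < #|G|.
  by rewrite -cardsT; apply/proper_card/properP; split=> //; exists v; rewrite !inE ?ltnn.
pose s := [ffun v => Ordinal (below_lt v)].
have s_diff u v : key u <= key v -> s u <= s v <= s u + (key v - key u).
  move=> uv; rewrite !ffunE /=.
  have sub : below u \subset below v.
    by apply/subsetP=> w; rewrite !inE => /leq_trans->.
  rewrite subset_leq_card //= -(setIidPr sub) -leq_subLR -cardsD.
  rewrite cardE -(size_map key) -(size_iota (key u) (key v - key u)).
  apply: uniq_leq_size; first by rewrite map_inj_uniq ?enum_uniq.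
  move=> _ /mapP[w + ->].
  by rewrite mem_enum !inE mem_iota subnKC // -leqNgt.
have s_inj : injective s.
  move=> u v suv; apply: key_inj; apply/eqP; rewrite eqn_leq.
  have le_key x y : s x = s y -> key y <= key x.
    move=> /(congr1 val); rewrite !ffunE /= leqNgt => eq_b; apply/negP=> xy.
    have : below x \proper below y.
      apply/properP; split; first by apply/subsetP=> w; rewrite !inE => /ltn_trans->.
      by exists x; rewrite !inE ?ltnn.
    by move/proper_card; rewrite eq_b ltnn.
  by rewrite !le_key.
have s_injb : injectiveb s by apply/injectiveP.
apply: leq_trans (bigmin_leq _ _ (mem_index_enum s) s_injb) _.
apply/bigmax_leqP=> -[u v] /= uv.
wlog le_uv : u v uv / key u <= key v.
  move=> IH; case/orP: (leq_total (key u) (key v)) => [|/IH]; first exact: IH.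
  by rewrite adj_sym distnC; apply.
have := key_adj v u; rewrite adj_sym => /(_ uv).
have /andP[le_s s_le] := s_diff _ _ le_uv => key_le.
rewrite distnEr // leq_subLR; apply: leq_trans s_le _.
by rewrite leq_add2l leq_subLR.
Qed.

End Bandwidth.

Section CrossGraph.
Local Open Scope set_scope.
Local Open Scope nat_scope.
Variable m : nat.
Hypothesis m_gt0 : 0 < m.

Local Notation G := (cross m.*2.+1).

(* Twelve keys for each concentric square layer around the center, three per
   arm, in the same order of arms in every layer. *)
Definition layer_key x y :=
  let thin := (m <= x.+1) && (x <= m.+1) in
  if thin && (m < y) then 12 * (y - m) + 9 + (x.+1 - m) else
  if thin && (y < m) then 12 * (m - y) + 6 + (x.+1 - m) else
  if m < x then 12 * (x - m) + 3 + (y.+1 - m) else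
  if x < m then 12 * (m - x) + (y.+1 - m) else 11.

Lemma cross_bandwidth : bandwidth G <= 12.
Proof.
apply: (@bandwidth_leq _ (fun v => layer_key (px v) (py v))) => u v.
  move: (in_crossP m_gt0 u) (in_crossP m_gt0 v) => uP vP eq_key.
  suff [] : px u = px v /\ py u = py v by apply: pxy_inj.
  by move: uP vP eq_key; rewrite /layer_key /in_cross /=; do 8?case: ifP => ?; lia.
rewrite cross_adjE; move: (in_crossP m_gt0 u) (in_crossP m_gt0 v).
by rewrite /layer_key /in_cross /=; do 8?case: ifP => ?; lia.
Qed.

End CrossGraph.

Section CrossConnectivity.
Local Open Scope set_scope.
Local Open Scope nat_scope.
Variable m : nat.
Hypothesis m_gt0 : 0 < m.

Local Notation G := (cross m.*2.+1).
Local Notation vtx := (vtx m_gt0).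

Definition grid_step x y x' y' :=
  (x == x') && ((y.+1 == y') || (y'.+1 == y)) ||
  ((x.+1 == x') || (x'.+1 == x)) && (y == y').

Lemma adj_vtx (v : G) x y : in_cross m x y ->
  adj v (vtx x y) = grid_step (px v) (py v) x y.
Proof. by move=> xy; rewrite cross_adjE px_vtx // py_vtx. Qed.

Definition dist_from a x := x - a + (a - x).

Lemma vtx_neq x y x' y' : in_cross m x y -> in_cross m x' y' ->
  (x != x') || (y != y') -> vtx x y != vtx x' y'.
Proof.
move=> xy xy' neq; apply/eqP=> /(vtx_inj xy xy')[ex ey].
by rewrite ex ey !eqxx in neq.
Qed.

(** Descent on the L1 distance to the corner [(m.+1, m.+1)] of the central 3 by 3 block; inside the
    block the chosen steps go around the missing center. *)
Lemma cross_minus_center_connected (S : {set G}) :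
  (forall x y, in_cross m x y -> (vtx x y \in S) = (x == m) && (y == m)) ->
  connected (induced (~: S)).
Proof.
move=> SE.
pose mu x y := dist_from m.+1 x + dist_from m.+1 y.
have root : in_cross m m.+1 m.+1 by rewrite /in_cross; lia.
apply: (@connected_descent _ _ (vtx m.+1 m.+1) (fun v => mu (px v) (py v))).
  by rewrite inE SE //; lia.
move=> v; rewrite -[v](vtxK m_gt0); have := in_crossP m_gt0 v.
move: (px v) (py v) => x y xy; rewrite inE SE // => xyS neq_root.
have {neq_root} neq_root : (x != m.+1) || (y != m.+1).
  by apply: contraNT neq_root; rewrite negb_or !negbK => /andP[/eqP-> /eqP->].
have cand x' y' : in_cross m x' y' -> ~~ ((x' == m) && (y' == m)) ->
    grid_step x y x' y' -> mu x' y' < mu x y ->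
    exists u, [/\ u \in ~: S, connect (adj_in (~: S)) (vtx x y) u
      & mu (px u) (py u) < mu (px (vtx x y)) (py (vtx x y))].
  move=> xy' nS st lt_mu; exists (vtx x' y').
  rewrite inE SE // !px_vtx // !py_vtx //; split=> //.
  by apply: adj_inP; rewrite ?inE ?SE // adj_vtx // px_vtx // py_vtx.
move: xy xyS neq_root cand; rewrite /in_cross /mu /dist_from /grid_step.
have [xg|xl] := ltnP m.+1 x.
  by move=> xy xyS _ cand; apply: (cand x.-1 y); lia.
have [xg|xl2] := ltnP x.+1 m.
  by move=> xy xyS _ cand; apply: (cand x.+1 y); lia.
have [yg|yl] := ltnP m.+1 y.
  by move=> xy xyS _ cand; apply: (cand x y.-1); lia.
have [yg|yl2] := ltnP y.+1 m.
  by move=> xy xyS _ cand; apply: (cand x y.+1); lia.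
have [xm|xm] := eqVneq x m.+1.
  by move=> xy xyS neq cand; apply: (cand x y.+1); lia.
have [ym|ym] := eqVneq y m.+1.
  by move=> xy xyS neq cand; apply: (cand x.+1 y); lia.
have [xm'|xm'] := eqVneq x m.
  by move=> xy xyS neq cand; apply: (cand x.+1 y); lia.
by move=> xy xyS neq cand; apply: (cand x y.+1); lia.
Qed.

Lemma cross_minus_vertex_connected (S : {set G}) :
  {in S &, forall u v, u = v} -> vtx m m \notin S ->
  connected (induced (~: S)).
Proof.
move=> S1 mS.
(* In an arm, a vertex whose inward neighbour is deleted moves sideways and then inward. From the
   middle of a line this preserves the L1 distance to the center; the added maximum makes the
   measure drop nevertheless. *)
pose mu x y := maxn (dist_from m x) (dist_from m y) + (dist_from m x + dist_from m y).
have root : in_cross m m m by rewrite /in_cross; lia.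
apply: (@connected_descent _ _ (vtx m m) (fun v => mu (px v) (py v))).
  by rewrite inE.
move=> v; rewrite -[v](vtxK m_gt0); have := in_crossP m_gt0 v.
move: (px v) (py v) => x y xy; rewrite inE => xyS neq_root.
have {neq_root} neq_root : (x != m) || (y != m).
  by apply: contraNT neq_root; rewrite negb_or !negbK => /andP[/eqP-> /eqP->].
have cand x' y' : in_cross m x' y' -> vtx x' y' \notin S ->
    grid_step x y x' y' -> mu x' y' < mu x y ->
    exists u, [/\ u \in ~: S, connect (adj_in (~: S)) (vtx x y) u
      & mu (px u) (py u) < mu (px (vtx x y)) (py (vtx x y))].
  move=> xy' nS st lt_mu; exists (vtx x' y').
  rewrite inE nS !px_vtx // !py_vtx //; split=> //.
  by apply: adj_inP; rewrite ?inE // adj_vtx // px_vtx // py_vtx.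
have detour x' y' x1 y1 x2 y2 :
    [&& in_cross m x' y', in_cross m x1 y1 & in_cross m x2 y2] ->
    [&& grid_step x y x' y', grid_step x y x1 y1 & grid_step x1 y1 x2 y2] ->
    (mu x' y' < mu x y) && (mu x2 y2 < mu x y) ->
    ((x' != x1) || (y' != y1)) && ((x' != x2) || (y' != y2)) ->
    exists u, [/\ u \in ~: S, connect (adj_in (~: S)) (vtx x y) u
      & mu (px u) (py u) < mu (px (vtx x y)) (py (vtx x y))].
  move=> /and3P[xy' xy1 xy2] /and3P[st' st1 st2] /andP[mu' mu2] /andP[neq1 neq2].
  have [inS|notS] := boolP (vtx x' y' \in S); last exact: cand notS _ _.
  have nS a b : in_cross m a b -> (x' != a) || (y' != b) -> vtx a b \notin S.
    move=> ab neq; apply: contraL (vtx_neq xy' ab neq) => abS.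
    by rewrite negbK (S1 _ _ inS abS).
  have [n1 n2] := (nS _ _ xy1 neq1, nS _ _ xy2 neq2).
  exists (vtx x2 y2); rewrite inE n2 !px_vtx // !py_vtx //; split=> //.
  by apply: (connect_trans (y := vtx x1 y1)); apply: adj_inP;
    rewrite ?inE // adj_vtx // px_vtx // py_vtx.
have mu_detour x' y' x1 y1 :
    in_cross m x' y' && in_cross m x1 y1 ->
    grid_step x y x' y' && grid_step x y x1 y1 ->
    (mu x' y' < mu x y) && (mu x1 y1 < mu x y) ->
    (x' != x1) || (y' != y1) ->
    exists u, [/\ u \in ~: S, connect (adj_in (~: S)) (vtx x y) u
      & mu (px u) (py u) < mu (px (vtx x y)) (py (vtx x y))].
  move=> /andP[xy' xy1] /andP[st' st1] /andP[mu' mu1] neq1.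
  have [inS|notS] := boolP (vtx x' y' \in S); last exact: cand notS _ _.
  apply: (cand x1 y1) => //; apply: contraL (vtx_neq xy' xy1 neq1) => x1S.
  by rewrite negbK (S1 _ _ inS x1S).
(* A neighbouring position across the arm, always within the three lanes: the side lanes go to the
   middle one, the middle lane to an outer one. *)
pose inw a := if a <= m then a.+1 else a.-1.
move: xy neq_root cand detour mu_detour.
rewrite /in_cross /mu /dist_from /grid_step.
have [xg|xl] := ltnP m.+1 x.
  by move=> xy neq cand detour _; apply: (detour x.-1 y x (inw y) x.-1 (inw y));
    rewrite /inw; case: ifP; lia.
have [xg|xl2] := ltnP x.+1 m.
  by move=> xy neq cand detour _; apply: (detour x.+1 y x (inw y) x.+1 (inw y));
    rewrite /inw; case: ifP; lia.
have [yg|yl] := ltnP m.+1 y.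
  by move=> xy neq cand detour _; apply: (detour x y.-1 (inw x) y (inw x) y.-1);
    rewrite /inw; case: ifP; lia.
have [yg|yl2] := ltnP y.+1 m.
  by move=> xy neq cand detour _; apply: (detour x y.+1 (inw x) y (inw x) y.+1);
    rewrite /inw; case: ifP; lia.
have [ex|xm] := eqVneq x m.
  by move=> xy neq cand _ _; apply: (cand m m) => //; lia.
have [ey|ym] := eqVneq y m.
  by move=> xy neq cand _ _; apply: (cand m m) => //; lia.
by move=> xy neq _ _ two; apply: (two m y x m); lia.
Qed.

Lemma cross_biconnected : k_connected 2 G.
Proof.
split.
  rewrite ltnNge; apply/negP=> le2.
  have u01 : vtx m m != vtx m m.+1 by apply: vtx_neq; rewrite /in_cross; lia.
  have u02 : vtx m m != vtx m.+1 m by apply: vtx_neq; rewrite /in_cross; lia.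
  have u12 : vtx m m.+1 != vtx m.+1 m by apply: vtx_neq; rewrite /in_cross; lia.
  have : #|[set vtx m m; vtx m m.+1; vtx m.+1 m]| <= 2.
    exact: leq_trans (max_card _) le2.
  by rewrite -setUA cardsU1 cards2 u12 !inE negb_or u01 u02.
move=> S ltS.
have S1 : {in S &, forall u v, u = v}.
  have /card_le1_eqP S1 : #|S| <= 1 by [].
  by move=> u v uS vS; rewrite (S1 u v).
have [mS|mS] := boolP (vtx m m \in S); last exact: cross_minus_vertex_connected.
apply: cross_minus_center_connected => x y xy.
have mm : in_cross m m m by rewrite /in_cross; lia.
apply/idP/andP=> [xyS|[/eqP-> /eqP-> //]].
by have [-> ->] := vtx_inj xy mm (S1 _ _ xyS mS).
Qed.

End CrossConnectivity.

(** * The bottleneck set *)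

Section HalfCross.
Local Open Scope set_scope.
Local Open Scope nat_scope.
Variable m : nat.
Hypothesis m_gt0 : 0 < m.

Local Notation l := m.*2.+1.
Local Notation G := (cross l).
Local Notation vtx := (vtx m_gt0).
Implicit Types (b h up : bool) (M : nat -> bool) (A : {set G}).

(** One side of the middle row or column, with an arbitrary part [M] of that line. Each vertex of
    the line has a neighbour in the adjacent line on either side, so every [M] gives two connected
    pieces: this is the source of [2 ^ l] states. *)
Definition half_cross h up M : {set G} :=
  [set v | let s := if h then px v else py v in
           let t := if h then py v else px v in
           if t == m then M s else if up then m < t else t < m].

Lemma half_setC h M : ~: half_cross h true M = half_cross h false (fun s => ~~ M s).
Proof.
apply/setP=> v; rewrite !inE /=; case: ifPn => // neq_m.
by rewrite -leqNgt leq_eqVlt (negPf neq_m).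
Qed.

Lemma vtx_half h up M x y : in_cross m x y ->
  (vtx x y \in half_cross h up M) =
  let s := if h then x else y in let t := if h then y else x in
  if t == m then M s else if up then m < t else t < m.
Proof. by move=> xy; rewrite inE px_vtx // py_vtx. Qed.

Lemma half_connected h up M : connected (induced (half_cross h up M)).
Proof.
pose b := if up then m.+1 else m.-1.
pose x0 := if h then m else b; pose y0 := if h then b else m.
pose mu x y := dist_from x0 x + dist_from y0 y.
have root : in_cross m x0 y0.
  by rewrite /x0 /y0 /b /in_cross; case: (h); case: (up); lia.
apply: (@connected_descent _ _ (vtx x0 y0) (fun v => mu (px v) (py v))).
  rewrite vtx_half // /x0 /y0 /b /=; move: m_gt0; clear.
  by case: h; case: up => /=; case: ifP; lia.
move=> v; rewrite -[v](vtxK m_gt0); have := in_crossP m_gt0 v.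
move: (px v) (py v) => x y xy xyA neq_root.
have {neq_root} neq_root : (x != x0) || (y != y0).
  by apply: contraNT neq_root; rewrite negb_or !negbK => /andP[/eqP-> /eqP->].
have cand x' y' : in_cross m x' y' -> vtx x' y' \in half_cross h up M ->
    grid_step x y x' y' -> mu x' y' < mu x y ->
    exists u, [/\ u \in half_cross h up M, connect (adj_in (half_cross h up M)) (vtx x y) u
      & mu (px u) (py u) < mu (px (vtx x y)) (py (vtx x y))].
  move=> xy' x'A st lt_mu; exists (vtx x' y').
  rewrite x'A !px_vtx // !py_vtx //; split=> //.
  by apply: adj_inP => //; rewrite adj_vtx // px_vtx // py_vtx.
(* The descent can be routed off the middle line, so membership of its next vertex does not depend
   on [M]. *)
have {}cand x' y' : in_cross m x' y' ->
    (let s := if h then x' else y' in let t := if h then y' else x' in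
     (t != m) && (if up then m < t else t < m)) ->
    grid_step x y x' y' -> mu x' y' < mu x y ->
    exists u, [/\ u \in half_cross h up M, connect (adj_in (half_cross h up M)) (vtx x y) u
      & mu (px u) (py u) < mu (px (vtx x y)) (py (vtx x y))].
  move=> xy' x'A; apply: cand => //; rewrite vtx_half //=.
  by move: x'A => /= /andP[/negPf->].
have {xyA} : let t := if h then y else x in (t == m) || (if up then m < t else t < m).
  by move: xyA; rewrite vtx_half //=; case: ifP.
move: xy neq_root cand.
rewrite /in_cross /mu /dist_from /grid_step /x0 /y0 /b {mu x0 y0 b root}.
have [xm|xm|xm] := ltngtP x m; have [ym|ym|ym] := ltngtP y m;
  case: h; case: up => //= xy neq cand yu.
all: try by apply: (cand x.+1 y); lia.
all: try by apply: (cand x.-1 y); lia.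
all: try by apply: (cand x y.+1); lia.
all: try by apply: (cand x y.-1); lia.
Qed.


Lemma half_contiguous2 h M : contiguous2 [set half_cross h true M; ~: half_cross h true M].
Proof.
by apply: contiguous2_pair; rewrite ?half_setC; apply: half_connected.
Qed.

Definition half_partition h (M : {ffun 'I_l -> bool}) : Omega G :=
  Sub _ (half_contiguous2 h (fun s => M (inord s))).

Lemma half_partition_inj h : injective (half_partition h).
Proof.
move=> M M' /(congr1 val) /= eMM'.
set A := half_cross h true _ in eMM'; set A' := half_cross h true _ in eMM'.
(* This vertex beside the center lies in every upper half, so it tells [A] from its complement in
   the unordered pair. *)
pose x0 := if h then m else m.+1; pose y0 := if h then m.+1 else m.
have root : in_cross m x0 y0 by rewrite /x0 /y0 /in_cross; case: (h); lia.
have rootA N : vtx x0 y0 \in half_cross h true N.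
  by rewrite vtx_half // /x0 /y0 /=; case: (h) => /=; case: eqP; lia.
have eA : A = A'.
  have : A \in [set A'; ~: A'] by rewrite -eMM' set21.
  rewrite !inE => /orP[/eqP // | /eqP eA].
  by have := rootA (fun s => M (inord s)); rewrite -/A eA inE rootA.
apply/ffunP=> i; pose x := if h then i : nat else m; pose y := if h then m else i : nat.
have xy : in_cross m x y.
  by rewrite /x /y /in_cross; have := ltn_ord i; case: (h); lia.
have /setP/(_ (vtx x y)) := eA; rewrite !vtx_half // /x /y /=.
by case: (h); rewrite eqxx inord_val.
Qed.

Definition arm_pos up k := if up then m + k else m - k.

(* Vertex [a] (0, 1 or 2) of the [k]-th transversal line of an arm, counted
   from the center; the arm is horizontal if [h], towards larger coordinates if
   [up]. *)
Definition cell h up k a : G :=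
  if h then vtx (arm_pos up k) (m + a).-1 else vtx (m + a).-1 (arm_pos up k).

Definition split A h up k := (cell h up k 0 \in A) != (cell h up k 2 \in A).

Definition splits A h up := [exists k : 'I_m, split A h up k.+1].

Lemma splits_setC A h up : splits (~: A) h up = splits A h up.
Proof.
apply: eq_existsb => k; rewrite /split !inE.
by do 2!case: (_ \in A).
Qed.

Definition crossing : {set Omega G} :=
  [set w : Omega G | [exists A in val w, splits A true true && splits A true false]].

Lemma in_crossing (w : Omega G) A : val w = [set A; ~: A] ->
  (w \in crossing) = splits A true true && splits A true false.
Proof.
move=> wA; rewrite inE wA; apply/exists_inP/idP=> [[B]|sA]; last first.
  by exists A; rewrite ?set21.
by rewrite !inE => /orP[]/eqP-> //; rewrite !splits_setC.
Qed.

Lemma in_cross_cell (up : bool) k a : k <= m -> a < 3 ->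
  in_cross m (arm_pos up k) (m + a).-1 && in_cross m (m + a).-1 (arm_pos up k).
Proof. by rewrite /arm_pos /in_cross; case: up; lia. Qed.

(** An arm along the cut has the two ends of each line on opposite sides; an arm across it lies
    wholly on one side. Hence horizontal cuts are in [crossing] and vertical cuts are not. The
    middle vertex [a = 1] is left out, as it may depend on [M]. *)
Lemma cell_half h h' up up' M k : 0 < k <= m ->
  forall a, a < 3 -> a != 1 ->
  (cell h up k a \in half_cross h' up' M) =
  if h == h' then (a == 0) (+) up' else up == up'.
Proof.
case/andP=> k_gt0 le_k a lt_a a1; have /andP[c1 c2] := in_cross_cell up le_k lt_a.
rewrite /cell; case: h; rewrite vtx_half //; case: h'; rewrite /= /arm_pos;
  case: ifP; case: up {c1 c2}; case: up' => /=; lia.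
Qed.

Lemma leq_crossing : 2 ^ l <= #|crossing|.
Proof.
have -> : 2 ^ l = #|{ffun 'I_l -> bool}| by rewrite card_ffun card_bool card_ord.
rewrite -(card_imset _ (@half_partition_inj true)) subset_leq_card //.
apply/subsetP=> _ /imsetP[M _ ->].
rewrite (in_crossing (A := half_cross true true (fun s => M (inord s)))) //.
by apply/andP; split; apply/existsP; exists (Ordinal m_gt0);
  rewrite /split !cell_half.
Qed.

Lemma leq_not_crossing : 2 ^ l <= #|~: crossing|.
Proof.
have -> : 2 ^ l = #|{ffun 'I_l -> bool}| by rewrite card_ffun card_bool card_ord.
rewrite -(card_imset _ (@half_partition_inj false)) subset_leq_card //.
apply/subsetP=> _ /imsetP[M _ ->]; rewrite inE.
rewrite (in_crossing (A := half_cross false true (fun s => M (inord s)))) //.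
rewrite negb_and; apply/orP; left; rewrite negb_exists; apply/forallP=> k.
by rewrite /split !cell_half //= ltn_ord.
Qed.

End HalfCross.

(** * Euler's relation *)

Section EdgeCount.
Local Open Scope set_scope.
Local Open Scope nat_scope.
Variables (V I : finType) (e1 e2 : I -> V) (g : pred I).
Implicit Types A B : {set V}.

(** Edges form an indexed family instead of a set of pairs, so that counting them later becomes a
    sum over arms and lines. *)
Definition linked B : rel V := [rel u v | [&& u \in B, v \in B &
  [exists i, g i && ((e1 i == u) && (e2 i == v) || (e1 i == v) && (e2 i == u))]]].

Definition inner_edges B : {set I} :=
  [set i | [&& g i, e1 i \in B & e2 i \in B]].

Lemma linked_sym B : symmetric (linked B).
Proof.
move=> u v; rewrite /linked /= andbCA; congr [&& _, _ & _].
by apply: eq_existsb => i; rewrite orbC.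
Qed.

(** Take a largest [X] inside [B] that satisfies the bound. An edge from [X] to a new vertex of [B]
    would add one vertex and at least one inner edge, so no such edge exists and [X = B]. *)
Lemma leq_card_inner_edges B :
  {in B &, forall u v, connect (linked B) u v} -> #|B| <= #|inner_edges B|.+1.
Proof.
have [->|/set0Pn[x xB] cB] := eqVneq B set0; first by rewrite cards0.
pose P (X : {set V}) := [&& x \in X, X \subset B & #|X| <= #|inner_edges X|.+1].
have P0 : P [set x] by rewrite /P set11 sub1set xB cards1.
case: (arg_maxnP (fun X : {set V} => #|X|) P0) => X /and3P[xX XB leX] maxX.
have [/existsP[u /existsP[v /and3P[uX vX uv]]]|closed] :=
  boolP [exists u, exists v, [&& u \in X, v \notin X & linked B u v]]; last first.
  suff -> : B = X by [].
  apply/eqP; rewrite eqEsubset XB andbT; apply/subsetP=> y yB.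
  apply: (connect_closed (R := fun z => z \in X) _ (cB _ _ xB yB) xX) => u v uv uX.
  apply: contraNT closed => vX; apply/existsP; exists u.
  by apply/existsP; exists v; rewrite uX vX.
have /and3P[_ vB /existsP[i /andP[gi ei]]] := uv.
have ltX : #|inner_edges X| < #|inner_edges (v |: X)|.
  apply/proper_card/properP; split.
    by apply/subsetP=> j; rewrite !inE => /and3P[-> -> ->]; rewrite !orbT.
  exists i; rewrite !inE gi /=; case/orP: ei => /andP[/eqP-> /eqP->];
    by rewrite ?uX ?(negPf vX) ?eqxx ?orbT ?andbF.
have : P (v |: X).
  rewrite /P !inE xX orbT subUset sub1set vB XB cardsU1 vX /=.
  by rewrite add1n ltnS (leq_trans leX).
by move/maxX; rewrite /= cardsU1 vX add1n ltnn.
Qed.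

Lemma leq_card_edges A :
  {in A &, forall u v, connect (linked A) u v} ->
  {in ~: A &, forall u v, connect (linked (~: A)) u v} ->
  #|V| <= (\sum_i g i).+2.
Proof.
move=> /leq_card_inner_edges cA /leq_card_inner_edges cB.
rewrite -(cardsC A); apply: leq_trans (leq_add cA cB) _.
have disj : inner_edges A :&: inner_edges (~: A) = set0.
  by apply/setP=> i; rewrite !inE; case: (e1 i \in A); rewrite ?andbF.
rewrite addSn addnS !ltnS -cardsUI disj cards0 addn0.
rewrite -sum1_card big_mkcond /= leq_sum // => i _.
by case: ifP => //; rewrite !inE => /orP[]/and3P[->].
Qed.

End EdgeCount.

Section CrossEuler.
Local Open Scope set_scope.
Local Open Scope nat_scope.
Variable m : nat.
Hypothesis m_gt0 : 0 < m.

Local Notation G := (cross m.*2.+1).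
Local Notation vtx := (vtx m_gt0).
Local Notation cell := (cell m_gt0).
Implicit Types (h up : bool) (A B : {set G}).

Lemma cell_vtx h up k a x y :
  (if h then (arm_pos m up k == x) && ((m + a).-1 == y)
   else (arm_pos m up k == y) && ((m + a).-1 == x)) ->
  cell h up k a = vtx x y.
Proof. by rewrite /cell; case: h => /andP[/eqP-> /eqP->]. Qed.

Lemma adj_cell_ind (P : G -> G -> Prop) :
  (forall u v, P u v -> P v u) ->
  (forall h up k a, k < m -> h || (0 < k) -> a < 3 ->
     P (cell h up k.+1 a) (cell h up k a)) ->
  (forall h up k a, k <= m -> h || (0 < k) -> a < 2 ->
     P (cell h up k a) (cell h up k a.+1)) ->
  forall u v, adj u v -> P u v.
Proof.
move=> Psym Pin Pside.
have PH x y : in_cross m x y -> in_cross m x.+1 y -> P (vtx x y) (vtx x.+1 y).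
  rewrite /in_cross => xy x1y.
  have [ys|ys] := boolP ((m <= y.+1) && (y <= m.+1)).
    have [le_m|lt_m] := leqP m x.
      rewrite -(@cell_vtx true true (x - m) (y.+1 - m)) /arm_pos; last lia.
      rewrite -(@cell_vtx true true (x - m).+1 (y.+1 - m)) /arm_pos; last lia.
      by apply/Psym/Pin; lia.
    rewrite -(@cell_vtx true false (m - x.+1).+1 (y.+1 - m)) /arm_pos; last lia.
    rewrite -(@cell_vtx true false (m - x.+1) (y.+1 - m)) /arm_pos; last lia.
    by apply/Pin; lia.
  have [lt_m|le_m] := ltnP m y.
    rewrite -(@cell_vtx false true (y - m) (x.+1 - m)) /arm_pos; last lia.
    rewrite -(@cell_vtx false true (y - m) (x.+1 - m).+1) /arm_pos; last lia.
    by apply/Pside; lia.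
  rewrite -(@cell_vtx false false (m - y) (x.+1 - m)) /arm_pos; last lia.
  rewrite -(@cell_vtx false false (m - y) (x.+1 - m).+1) /arm_pos; last lia.
  by apply/Pside; lia.
have PV x y : in_cross m x y -> in_cross m x y.+1 -> P (vtx x y) (vtx x y.+1).
  rewrite /in_cross => xy xy1.
  have [ys|ys] := boolP ((m <= y.+1) && (y <= m)).
    have [le_m|lt_m] := leqP m x.
      rewrite -(@cell_vtx true true (x - m) (y.+1 - m)) /arm_pos; last lia.
      rewrite -(@cell_vtx true true (x - m) (y.+1 - m).+1) /arm_pos; last lia.
      by apply/Pside; lia.
    rewrite -(@cell_vtx true false (m - x) (y.+1 - m)) /arm_pos; last lia.
    rewrite -(@cell_vtx true false (m - x) (y.+1 - m).+1) /arm_pos; last lia.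
    by apply/Pside; lia.
  have [lt_m|le_m] := ltnP m y.
    rewrite -(@cell_vtx false true (y - m) (x.+1 - m)) /arm_pos; last lia.
    rewrite -(@cell_vtx false true (y - m).+1 (x.+1 - m)) /arm_pos; last lia.
    by apply/Psym/Pin; lia.
  rewrite -(@cell_vtx false false (m - y.+1).+1 (x.+1 - m)) /arm_pos; last lia.
  rewrite -(@cell_vtx false false (m - y.+1) (x.+1 - m)) /arm_pos; last lia.
  by apply/Pin; lia.
move=> u v; rewrite cross_adjE => uv.
rewrite -[u](vtxK m_gt0) -[v](vtxK m_gt0).
move: uv (in_crossP m_gt0 u) (in_crossP m_gt0 v).
move: (px u) (py u) (px v) (py v) => x y x' y'.
case/orP=> /andP[].
  by move=> /eqP<- /orP[]/eqP<- uP vP; [apply: PV | apply/Psym/PV].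
by move=> /orP[]/eqP<- /eqP<- uP vP; [apply: PH | apply/Psym/PH].
Qed.

Variable A : {set G}.

Definition same (u v : G) := (u \in A) == (v \in A).

(* Edges between line [k.+1] and line [k] of an arm ([e < 3]) and edges within
   line [k.+1], besides the two edges within the middle line [k = 0]. The first
   line of a vertical arm consists of vertices of the horizontal arms. *)
Local Notation edge_index := ('I_2 + bool * bool * 'I_m * 'I_5)%type.

Definition edge_fst (i : edge_index) : G :=
  match i with
  | inl a => cell true true 0 a
  | inr (h, up, k, e) => cell h up k.+1 (if e < 3 then e : nat else e - 3)
  end.

Definition edge_snd (i : edge_index) : G :=
  match i with
  | inl a => cell true true 0 a.+1
  | inr (h, up, k, e) =>
      if e < 3 then cell h up k e else cell h up k.+1 (e - 2)
  end.

(* From each monochromatic unit square one edge is removed, which does not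
   change connectivity. *)
Definition kept : pred edge_index := fun i =>
  same (edge_fst i) (edge_snd i) &&
  match i with
  | inl _ => true
  | inr (h, up, k, e) =>
      (h || (0 < k)) &&
      ((0 < e < 3) ==> ~~ (same (cell h up k.+1 e) (cell h up k.+1 e.-1) &&
                           same (cell h up k.+1 e) (cell h up k e.-1)))
  end.

(** A removed edge between lines [k.+1] and [k] at position [a.+1] is bypassed around its
    monochromatic square: along line [k.+1], inward at position [a], and back along line [k].
    Induction on [a] handles the inward edge of the detour. *)
Lemma kept_connected B :
  connected (induced B) -> {in B, forall u v, same u v = (v \in B)} ->
  {in B &, forall u v, connect (linked edge_fst edge_snd kept B) u v}.
Proof.
move=> cB sB; set K := linked _ _ _ _.
have Ksym : connect_sym K by apply: sym_connect_sym; apply: linked_sym.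
have Kedge i : kept i -> edge_fst i \in B -> edge_snd i \in B ->
    connect K (edge_fst i) (edge_snd i).
  move=> ki iB iB'; apply/connect1/and3P; split=> //.
  by apply/existsP; exists i; rewrite ki !eqxx.
pose sides h up k := forall a, a < 2 -> cell h up k a \in B ->
  cell h up k a.+1 \in B -> connect K (cell h up k a) (cell h up k a.+1).
have side_edge h up k : k < m -> h || (0 < k) -> sides h up k.+1.
  move=> lt_k hk a lt_a aB aB'.
  have lt5 : a + 3 < 5 by lia.
  have e0 : (a + 3 < 3) = false by lia.
  have := Kedge (inr (h, up, Ordinal lt_k, Ordinal lt5)).
  rewrite /kept /= e0 addnK (_ : a + 3 - 2 = a.+1); last lia.
  by apply=> //; rewrite sB // aB' hk andbF.
have inward h up k : k < m -> h || (0 < k) -> sides h up k -> forall a, a < 3 ->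
    cell h up k.+1 a \in B -> cell h up k a \in B ->
    connect K (cell h up k.+1 a) (cell h up k a).
  move=> lt_k hk side_k; elim=> [|a IHa] lt_a aB aB'.
    have := Kedge (inr (h, up, Ordinal lt_k, (@Ordinal 5 0 isT))).
    by apply=> //; rewrite /kept /= sB // aB' hk.
  have lt5 : a.+1 < 5 by lia.
  have := Kedge (inr (h, up, Ordinal lt_k, Ordinal lt5)).
  rewrite /kept /= lt_a sB // aB' hk /=.
  case: (boolP (_ && _)) => [/andP[s1 s2] _|_]; last exact.
  have a1B : cell h up k.+1 a \in B by rewrite -(sB _ aB).
  have a0B : cell h up k a \in B by rewrite -(sB _ aB).
  have lt_a' : a < 2 by lia.
  apply: connect_trans (side_k a lt_a' a0B aB').
  apply: connect_trans (IHa _ a1B a0B); last lia.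
  by rewrite Ksym; apply: side_edge.
have sides_h up k : k <= m -> sides true up k.
  case: k => [|k] lt_k; last exact: side_edge.
  have cell0 a : cell true up 0 a = cell true true 0 a.
    by apply: cell_vtx; rewrite /arm_pos; case: (up); lia.
  move=> a lt_a; rewrite !cell0 => aB aB'.
  by have := Kedge (inl (Ordinal lt_a)); apply=> //; rewrite /kept /= sB ?aB'.
have inward_h up k a : k < m -> a < 3 -> cell true up k.+1 a \in B ->
    cell true up k a \in B -> connect K (cell true up k.+1 a) (cell true up k a).
  by move=> lt_k; apply: inward => //; apply/sides_h/ltnW.
have sides_v up k : k <= m -> 0 < k -> sides false up k.
  case: k => // -[_ _|k lt_k _]; last exact: side_edge.
  pose b := if up then 2 else 0.
  have cell1 right a : a <= 1 -> cell true right a b =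
      cell false up 1 (if right then a.+1 else 1 - a).
    by rewrite /cell /arm_pos /b; case: (up); case: right => ?; congr (vtx _ _); lia.
  have lt_b : b < 3 by rewrite /b; case: (up).
  case=> [|[|//]] _.
    by rewrite -(cell1 false 1) // -(cell1 false 0) // => ? ?; apply: inward_h.
  rewrite -(cell1 true 1) // -(cell1 true 0) // => ? ?; rewrite Ksym.
  exact: inward_h.
have : forall u v, adj u v -> u \in B -> v \in B -> connect K u v.
  apply: adj_cell_ind => [u v uv uB vB|h up k a lt_k hk lt_a|h up k a le_k hk lt_a].
  - by rewrite Ksym; apply: uv.
  - apply: inward => //; case: h hk => [_|k_gt0]; first exact/sides_h/ltnW.
    by apply/sides_v => //; apply: ltnW.
  by case: h hk => [_|k_gt0]; [apply: sides_h | apply: sides_v].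
move=> Kadj u v uB vB; move/connected_inducedP: cB => /(_ u v uB vB) uv.
apply: (connect_closed (R := fun w => connect K u w) _ uv (connect0 _ _)) => x y.
by case/and3P=> xB yB xy ux; apply: connect_trans ux (Kadj _ _ xy xB yB).
Qed.

Hypotheses (cA : connected (induced A)) (cB : connected (induced (~: A))).

Lemma leq_card_kept : #|G| <= (\sum_i kept i).+2.
Proof.
apply: (@leq_card_edges _ _ edge_fst edge_snd _ A).
  apply: kept_connected => // u uA v.
  by rewrite /same uA; case: (v \in A).
apply: kept_connected => // u; rewrite inE => /negPf uA v.
by rewrite /same uA inE; case: (v \in A).
Qed.

Definition col h up k a := cell h up k a \in A.

Definition runs h up k :=
  1 + (col h up k 0 != col h up k 1) + (col h up k 1 != col h up k 2).

Definition turns h up k :=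
  (col h up k 0 != col h up k.+1 0) + (col h up k 2 != col h up k.+1 2).

Definition line_edges h up k :=
  (col h up k.+1 0 == col h up k 0) +
  (col h up k.+1 1 == col h up k 1) *
    ~~ ((col h up k.+1 1 == col h up k.+1 0) && (col h up k.+1 1 == col h up k 0)) +
  (col h up k.+1 2 == col h up k 2) *
    ~~ ((col h up k.+1 2 == col h up k.+1 1) && (col h up k.+1 2 == col h up k 1)) +
  (col h up k.+1 0 == col h up k.+1 1) + (col h up k.+1 1 == col h up k.+1 2).

(** A new line adds three vertices and three kept edges, up to the change of the potential [runs],
    which telescopes along the arm; each turn of an outer row costs half an edge. The inequality is
    local to two consecutive lines and is checked on their 64 colorings. *)
Lemma line_edges_leq h up k :
  2 * line_edges h up k + runs h up k.+1 + turns h up k <= 6 + runs h up k.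
Proof.
rewrite /line_edges /runs /turns.
case: (col h up k 0); case: (col h up k 1); case: (col h up k 2);
by case: (col h up k.+1 0); case: (col h up k.+1 1); case: (col h up k.+1 2).
Qed.

Lemma sum_line_edges_leq h up k0 n :
  2 * \sum_(k0 <= k < k0 + n) line_edges h up k + runs h up (k0 + n)
    + \sum_(k0 <= k < k0 + n) turns h up k <= 6 * n + runs h up k0.
Proof.
elim: n => [|n IHn]; first by rewrite addn0 !big_geq //; lia.
rewrite (addnS k0 n) !big_nat_recr ?leq_addr //=.
by have := line_edges_leq h up (k0 + n); lia.
Qed.

Lemma sum_kept_line h up (k : 'I_m) :
  \sum_(e < 5) kept (inr (h, up, k, e)) = (h || (0 < k)) * line_edges h up k.
Proof.
rewrite !big_ord_recl big_ord0 /kept /= /same /= /bump /= -!/(col _ _ _ _).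
rewrite /line_edges; case: (_ || _).
  case: (col h up k 0); case: (col h up k 1); case: (col h up k 2);
  by case: (col h up k.+1 0); case: (col h up k.+1 1); case: (col h up k.+1 2).
by rewrite !andbF.
Qed.

Lemma sum_kept :
  \sum_i kept i = (col true true 0 0 == col true true 0 1) +
    (col true true 0 1 == col true true 0 2) +
    \sum_(p : bool * bool) \sum_(0 <= k < m) (p.1 || (0 < k)) * line_edges p.1 p.2 k.
Proof.
rewrite big_sumType /=; congr (_ + _).
  rewrite !big_ord_recl big_ord0 /kept /same /= /bump /= !andbT.
  by rewrite /col /cell /arm_pos /= !addn0.
transitivity (\sum_(p : bool * bool) \sum_(k < m) \sum_(e < 5)
    kept (inr (p.1, p.2, k, e))).
  by rewrite !pair_bigA /=; apply: eq_bigr => -[[[h up] k] e].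
apply: eq_bigr => -[h up] _; rewrite big_mkord; apply: eq_bigr => k _.
exact: sum_kept_line.
Qed.

Lemma leq_card_cross : 12 * m <= #|G| + 3.
Proof.
pose J := ('I_3 + bool * 'I_m * 'I_3 + bool * 'I_m.-1 * 'I_3)%type.
pose xy (j : J) : nat * nat :=
  match j with
  | inl (inl a) => (m, (m + a).-1)
  | inl (inr (up, k, a)) => (arm_pos m up k.+1, (m + a).-1)
  | inr (up, k, a) => ((m + a).-1, arm_pos m up k.+2)
  end.
have xy_in j : in_cross m (xy j).1 (xy j).2.
  case: j => [[[a lt_a]|[[up [k lt_k]] [a lt_a]]]|[[up [k lt_k]] [a lt_a]]];
    rewrite /in_cross /xy /arm_pos /=; first lia; by case: up; lia.
have ordE n i j (lt_i : i < n) (lt_j : j < n) : i = j -> Ordinal lt_i = Ordinal lt_j.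
  by move=> ij; apply: val_inj.
have xy_inj : injective xy.
  move=> [[[a lt_a]|[[up [k lt_k]] [a lt_a]]]|[[up [k lt_k]] [a lt_a]]];
  move=> [[[b lt_b]|[[up' [k' lt_k']] [b lt_b]]]|[[up' [k' lt_k']] [b lt_b]]] [];
  rewrite /xy /arm_pos /=; try (case: up); try (case: up'); move=> *;
  try (by exfalso; lia).
  - by rewrite (ordE _ _ _ lt_a lt_b) //; lia.
  1-4: by rewrite (ordE _ _ _ lt_a lt_b) ?(ordE _ _ _ lt_k lt_k') //; lia.
have f_inj : injective (fun j => vtx (xy j).1 (xy j).2).
  move=> i j /vtx_inj[] // ex ey; apply: xy_inj.
  by rewrite [LHS]surjective_pairing ex ey -surjective_pairing.
have := leq_card _ f_inj; rewrite !card_sum !card_prod !card_ord card_bool.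
lia.
Qed.

(* The first summand counts the color changes along the tip of the arm. *)
Definition boundary_turns h up :=
  (runs h up m).-1 + \sum_(1 <= k < m) turns h up k.

(* Euler's relation, which replaces a planarity argument: at least #|G| - 2 edges
   are kept, and an arm keeps the fewer edges, the more often its outer rows
   change color. *)
Lemma sum_boundary_turns :
  boundary_turns true true + boundary_turns true false +
  (boundary_turns false true + boundary_turns false false) <= 2.
Proof.
have := leq_card_kept; have := leq_card_cross; rewrite sum_kept.
rewrite -(pair_bigA _ (fun h up =>
  \sum_(0 <= k < m) (h || (0 < k)) * line_edges h up k)) /=.
rewrite !big_bool /=.
have horiz up : \sum_(0 <= k < m) true * line_edges true up k =
    \sum_(0 <= k < 0 + m) line_edges true up k.
  by apply: eq_bigr => k _; rewrite mul1n.
have vert up : \sum_(0 <= k < m) (0 < k) * line_edges false up k =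
    \sum_(1 <= k < 1 + m.-1) line_edges false up k.
  rewrite big_ltn // mul0n add0n add1n prednK //.
  by apply: eq_big_nat => k /andP[k_gt0 _]; rewrite k_gt0 mul1n.
rewrite !horiz !vert.
have := sum_line_edges_leq true true 0 m; have := sum_line_edges_leq true false 0 m.
have := sum_line_edges_leq false true 1 m.-1; have := sum_line_edges_leq false false 1 m.-1.
rewrite /boundary_turns !add0n add1n prednK //.
have split0 up : \sum_(0 <= k < m) turns true up k =
    turns true up 0 + \sum_(1 <= k < m) turns true up k.
  by rewrite big_ltn.
rewrite !split0.
have runs_gt0 h up k : 0 < runs h up k by [].
have c0 up a : col true up 0 a = col true true 0 a.
  by rewrite /col; congr (_ \in A); apply: cell_vtx; rewrite /arm_pos; case: up; lia.
have c1 up up' a : a <= 1 -> col false up 1 (if up' then a.+1 else 1 - a) =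
    col true up' a (if up then 2 else 0).
  move=> a1; rewrite /col; congr (_ \in A); rewrite /cell /arm_pos.
  by case: up; case: up'; congr (vtx _ _); lia.
have runs1 : runs false true 1 + runs false false 1 =
    2 + turns true true 0 + turns true false 0.
  have [e1 e2 e3] := And3 (c1 true false 1 isT) (c1 true false 0 isT) (c1 true true 1 isT).
  have [e4 e5 e6] := And3 (c1 false false 1 isT) (c1 false false 0 isT) (c1 false true 1 isT).
  rewrite /= in e1 e2 e3 e4 e5 e6.
  rewrite /runs /turns e1 e2 e3 e4 e5 e6 !(c0 false).
  move: (col true false 1 2) (col true true 0 2) (col true true 1 2).
  move: (col true false 1 0) (col true true 0 0) (col true true 1 0).
  by do 6!case.
have runs0 : runs true false 0 = runs true true 0 by rewrite /runs !(c0 false).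
have edges0 : (col true true 0 0 == col true true 0 1) +
    (col true true 0 1 == col true true 0 2) + runs true true 0 = 3.
  by rewrite /runs; do 3!case: (col _ _ _ _).
(* Twice the number of kept edges is at least 24m - 10 and at most 24m - 4 minus the tip runs and
   the turns. So these add up to at most 6, and each of the four tips has at least one run, which
   leaves 2. *)
have := runs_gt0 true true m; have := runs_gt0 true false m.
have := runs_gt0 false true m; have := runs_gt0 false false m.
move: runs1 runs0 edges0; lia.
Qed.

End CrossEuler.

(** * Counting the states that leave the bottleneck set *)

Section IntervalCodes.
Local Open Scope nat_scope.
Variable m : nat.

(** Code of a sequence that changes at most twice: a starting color and two positions after which it
    is flipped. *)
Definition two_switches (c : bool * 'I_m.+1 * 'I_m.+1) k :=
  c.1.1 (+) (c.1.2 < k) (+) (c.2 < k).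

Lemma two_switchesP (f : nat -> bool) : 0 < m ->
  \sum_(1 <= k < m) (f k != f k.+1) <= 2 ->
  exists c, forall k, 0 < k <= m -> f k = two_switches c k.
Proof.
move=> m_gt0 le2.
pose S n := \sum_(1 <= k < n) (f k != f k.+1).
(* A position equal to [m] stands for a switch that is not used yet. *)
suff gen n : 0 < n <= m -> S n <= 2 -> exists s p q,
    [/\ (p < n) || (p == m), (q < n) || (q == m),
    (S n <= 1 -> q = m), (S n = 0 -> p = m)
  & forall k, 0 < k <= n -> f k = s (+) (p < k) (+) (q < k)].
  have m_in : 0 < m <= m by rewrite m_gt0 leqnn.
  have [s [p [q [p_le q_le _ _ fE]]]] := gen m m_in le2.
  have le_p : p < m.+1 by lia.
  have le_q : q < m.+1 by lia.
  by exists (s, Ordinal le_p, Ordinal le_q).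
elim: n => // -[_ /andP[_ lt_m] _|n IHn /andP[_ lt_m]].
  exists (f 1), m, m; rewrite eqxx orbT; split=> // -[|[|//]] // _.
  by rewrite ltnNge lt_m !addbF.
rewrite /S big_nat_recr //= -/(S n.+1) => le_S.
have n_in : 0 < n.+1 <= m by lia.
have le_S' : S n.+1 <= 2 by lia.
have [s [p [q [p_le q_le qm pm fE]]]] := IHn n_in le_S'.
have fn1 : f n.+1 = s (+) (p < n.+1) (+) (q < n.+1) by apply: fE; rewrite ltnSn.
have same_switch r : (r < n.+1) || (r == m) -> (r < n.+2) = (r < n.+1) by lia.
case: (eqVneq (f n.+1) (f n.+2)) le_S => [eq_f|neq_f] le_S.
  rewrite addn0; exists s, p, q; split=> //; [lia | lia |] => k /andP[k_gt0].
  rewrite leq_eqVlt => /orP[/eqP->|lt_k]; last by apply: fE; rewrite k_gt0.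
  by rewrite -eq_f fn1 !same_switch.
have {}neq_f : f n.+2 = ~~ f n.+1 by move: neq_f; do 2!case: (f _).
have q_m : q = m by apply: qm; lia.
have [S0|S1] := posnP (S n.+1).
  exists s, n.+1, m; rewrite eqxx orbT; split=> //; [by rewrite ltnSn | lia |].
  move=> k /andP[k_gt0]; rewrite leq_eqVlt => /orP[/eqP->|lt_k].
    have [e1 e2] : (m < n.+1) = false /\ (m < n.+2) = false by lia.
    by rewrite neq_f fn1 (pm S0) q_m ltnSn e1 e2 !addbF addbT.
  have e1 : (n.+1 < k) = false by lia.
  have e2 : (m < k) = false by lia.
  by rewrite fE ?k_gt0 // q_m (pm S0) e1 e2.
exists s, p, n.+1; split=> //; [lia | by rewrite ltnSn | lia | lia |].
move=> k /andP[k_gt0]; rewrite leq_eqVlt => /orP[/eqP->|lt_k].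
  have e1 : (m < n.+1) = false by lia.
  by rewrite neq_f fn1 q_m ltnSn e1 same_switch // addbF addbT.
have e1 : (n.+1 < k) = false by lia.
have e2 : (m < k) = false by lia.
by rewrite fE ?k_gt0 // q_m e1 e2.
Qed.

Definition ends_of (c : 'I_m.+1 * 'I_m.+1) k := (k <= c.1) || (c.2 < k).

(** Take the longest initial and the longest final segment of 1, ..., m on which [f] holds; by
    hypothesis every position where [f] holds lies in one of them. *)
Lemma ends_ofP (f : pred nat) :
  (forall k, 0 < k <= m -> f k ->
     (forall j, k <= j <= m -> f j) \/ (forall j, 0 < j <= k -> f j)) ->
  exists c, forall k, 0 < k <= m -> f k = ends_of c k.
Proof.
move=> fP.
pose P k := (k <= m) && all f (iota 1 k).
pose Q k := all f (iota k.+1 (m - k)).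
have P0 : exists k, P k by exists 0.
have Pm k : P k -> k <= m by case/andP.
have Qm : exists k, Q k by exists m; rewrite /Q subnn.
have [p /andP[le_p /allP fp] maxp] := ex_maxnP P0 Pm.
have [q /allP fq minq] := ex_minnP Qm.
have le_q : q <= m by apply: minq; rewrite /Q subnn.
exists (Ordinal (le_p : p < m.+1), Ordinal (le_q : q < m.+1)) => k k_in.
rewrite /ends_of /=; apply/idP/orP=> [fk|[le_k|lt_k]].
- have [fj|fj] := fP _ k_in fk.
    right; suff: q <= k.-1 by case/andP: k_in; case: (k).
    apply: minq; apply/allP=> j; rewrite mem_iota => j_in; apply: fj; lia.
  left; apply: maxp; rewrite /P; case/andP: k_in => _ -> /=.
  by apply/allP=> j; rewrite mem_iota => j_in; apply: fj; lia.
- by apply: fp; rewrite mem_iota; lia.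
by apply: fq; rewrite mem_iota; lia.
Qed.

End IntervalCodes.

Section CrossCoding.
Local Open Scope set_scope.
Local Open Scope nat_scope.
Variable m : nat.
Hypothesis m_gt0 : 0 < m.

Local Notation G := (cross m.*2.+1).
Local Notation vtx := (vtx m_gt0).
Local Notation cell := (cell m_gt0).
Local Notation col := (col m_gt0).
Local Notation runs := (runs m_gt0).
Implicit Types (h up : bool) (A B : {set G}).

Lemma cell_coord h up k a : k <= m -> a < 3 ->
  px (cell h up k a) = (if h then arm_pos m up k else (m + a).-1) /\
  py (cell h up k a) = (if h then (m + a).-1 else arm_pos m up k).
Proof.
move=> le_k lt_a; have /andP[c1 c2] := in_cross_cell m_gt0 up le_k lt_a.
by rewrite /cell; case: h; rewrite px_vtx // py_vtx.
Qed.

Lemma cell_cover (v : G) : v = vtx m m \/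
  exists h up k a, [/\ k < m, a < 3 & v = cell h up k.+1 a].
Proof.
rewrite -[v](vtxK m_gt0); move: (in_crossP m_gt0 v).
move: (px v) (py v) => x y; rewrite /in_cross => xy.
have cellE h up k a : k < m -> a < 3 ->
    (if h then (arm_pos m up k.+1 == x) && ((m + a).-1 == y)
     else (arm_pos m up k.+1 == y) && ((m + a).-1 == x)) ->
    exists h up k a, [/\ k < m, a < 3 & vtx x y = cell h up k.+1 a].
  by move=> lt_k lt_a e; exists h, up, k, a; split=> //; rewrite (cell_vtx m_gt0 e).
have [ys|ys] := boolP ((m <= y.+1) && (y <= m.+1)).
  have [xm|xm|xm] := ltngtP x m.
  - by right; apply: (cellE true false (m - x).-1 (y.+1 - m)); rewrite /arm_pos /=; lia.
  - by right; apply: (cellE true true (x - m).-1 (y.+1 - m)); rewrite /arm_pos /=; lia.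
  have [ym|ym|ym] := ltngtP y m.
  - by right; apply: (cellE false false 0 1); rewrite /arm_pos /=; lia.
  - by right; apply: (cellE false true 0 1); rewrite /arm_pos /=; lia.
  by left; rewrite xm ym.
right; have [ym|ym] := ltnP y m.
  by apply: (cellE false false (m - y).-1 (x.+1 - m)); rewrite /arm_pos /=; lia.
by apply: (cellE false true (y - m).-1 (x.+1 - m)); rewrite /arm_pos /=; lia.
Qed.

Lemma cell_line_inj h up k k' a a' : 0 < k <= m -> 0 < k' <= m -> a < 3 -> a' < 3 ->
  cell h up k a = cell h up k' a' -> k = k'.
Proof.
move=> k_in k'_in lt_a lt_a' e.
have [|//|xk yk] := @cell_coord h up k a; first by case/andP: k_in.
have [|//|xk' yk'] := @cell_coord h up k' a'; first by case/andP: k'_in.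
by move: xk yk xk' yk'; rewrite e /arm_pos; case: h {e}; case: up; lia.
Qed.

Lemma runs_eq1P A h up k :
  reflect (forall a, a < 3 -> col A h up k a = col A h up k 0) (runs A h up k == 1).
Proof.
rewrite /runs; apply: (iffP idP) => [|cE]; last by rewrite (cE 1) // (cE 2) // eqxx.
by move=> + [|[|[|//]]] _ //; do 3!case: (col _ _ _ _ _).
Qed.

(* A monochromatic line separates the outer part of its arm from the rest of
   the cross, and the other color class lies on one side of it. *)
Lemma mono_side A h up k :
  connected (induced A) -> connected (induced (~: A)) -> 0 < k <= m ->
  runs A h up k == 1 ->
  (forall j, k <= j <= m -> runs A h up j == 1) \/
  (forall j, 0 < j <= k -> runs A h up j == 1).
Proof.
move=> cA cB k_in /runs_eq1P mono_k.
pose B := if col A h up k 0 then ~: A else A.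
have {}cB : connected (induced B) by rewrite /B; case: ifP.
have inB v : (v \in B) = ((v \in A) != col A h up k 0).
  by rewrite /B; case: (col A h up k 0); rewrite ?inE; case: (v \in A).
have line_k a : a < 3 -> cell h up k a \notin B.
  by move=> lt_a; rewrite inB negbK [X in X == _](mono_k a lt_a).
have monoP j : (forall a, a < 3 -> cell h up j a \notin B) -> runs A h up j == 1.
  move=> jB; have colE a : a < 3 -> col A h up j a = col A h up k 0.
    by move=> lt_a; apply/eqP; have := jB a lt_a; rewrite inB negbK.
  by apply/runs_eq1P=> a lt_a; rewrite !colE.
pose R := [set v : G | let s := if h then px v else py v in
  if up then m + k < s else s + k < m].
(* [R] is the part of the arm beyond line [k]. An edge leaving [R] ends on line [k], which contains
   no vertex of [B]. *)
have RB : {in B &, forall u v, adj u v -> u \in R -> v \in R}.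
  move=> u v uB vB uv uR; apply: contraLR vB => vR.
  have -> : v = cell h up k ((if h then py v else px v).+1 - m).
    rewrite -[LHS](vtxK m_gt0); apply/esym/cell_vtx; move: uR vR uv.
    rewrite !inE cross_adjE; have := in_crossP m_gt0 u; have := in_crossP m_gt0 v.
    by rewrite /in_cross /arm_pos; case: (h); case: (up) => /=; lia.
  apply: line_k; move: uR vR uv.
  rewrite !inE cross_adjE; have := in_crossP m_gt0 u; have := in_crossP m_gt0 v.
  by rewrite /in_cross; case: (h); case: (up) => /=; lia.
have [/existsP[u /andP[uB uR]]|noB] := boolP [exists u, (u \in B) && (u \in R)].
  right=> j j_in; apply: monoP => a lt_a; apply/negP=> aB.
  have := connected_closed cB RB uB aB uR; rewrite inE.
  have [|//|ex ey] := @cell_coord h up j a; first by lia.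
  by rewrite ex ey /arm_pos; case: (h); case: (up); lia.
left=> j /andP[le_kj le_j]; apply: monoP => a lt_a.
have [<-|neq_kj] := eqVneq k j; first exact: line_k.
apply: contra noB => aB; apply/existsP; exists (cell h up j a); rewrite aB inE.
have [//|//|ex ey] := @cell_coord h up j a.
by rewrite ex ey /arm_pos; case: (h); case: (up); lia.
Qed.

Lemma split_boundary_turns A h up k : 0 < k <= m -> split m_gt0 A h up k ->
  0 < boundary_turns m_gt0 A h up.
Proof.
move=> /andP[k_gt0 le_k]; rewrite lt0n; apply: contraL.
rewrite /boundary_turns addn_eq0 => /andP[runs_m /eqP turns0].
have turn0 j : 0 < j < m -> turns m_gt0 A h up j = 0.
  move=> j_in; have : turns m_gt0 A h up j <= 0; last by case: (turns _ _ _ _ _).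
  rewrite -[leqRHS]turns0 (big_rem j) /= ?leq_addr // mem_index_iota //.
have eq_m : col A h up m 2 = col A h up m 0.
  exact: (elimT (runs_eq1P A h up m)).
have : forall n, n <= m - k -> col A h up (m - n) 2 = col A h up (m - n) 0.
  elim=> [|n IHn] lt_n; first by rewrite subn0.
  have := turn0 (m - n.+1); rewrite /turns (_ : (m - n.+1).+1 = m - n); last by lia.
  have {}IHn := IHn (ltnW lt_n); rewrite IHn => t0.
  have {}t0 := t0 ltac:(lia); move: t0.
  by do 3!case: (col _ _ _ _ _).
move/(_ _ (leqnn _)); rewrite subKn // => e2.
by rewrite /split -/(col A h up k 0) -/(col A h up k 2) e2 eqxx.
Qed.

End CrossCoding.

Section CrossBoundary.
Local Open Scope set_scope.
Local Open Scope nat_scope.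
Variable m : nat.
Hypothesis m_gt0 : 0 < m.

Local Notation G := (cross m.*2.+1).
Local Notation vtx := (vtx m_gt0).
Local Notation cell := (cell m_gt0).
Local Notation col := (col m_gt0).
Local Notation runs := (runs m_gt0).
Implicit Types (h up : bool) (A B : {set G}).

Local Notation row_code := (bool * 'I_m.+1 * 'I_m.+1)%type.
Local Notation arm_code := (row_code * row_code * ('I_m.+1 * 'I_m.+1))%type.
Local Notation code :=
  ({ffun bool * bool -> arm_code} * bool * bool * bool * {ffun 'I_m -> bool})%type.

(* The two outer rows of the arm are given by their color switches. A line
   whose ends agree is determined by whether it is monochromatic, and a line
   whose ends differ by [mid]. *)
Definition arm_color (c : arm_code) (mid : nat -> bool) k a :=
  let r0 := two_switches c.1.1 k in
  let r2 := two_switches c.1.2 k in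
  if a == 0 then r0 else if a == 2 then r2 else
  if r0 == r2 then r0 (+) ~~ ends_of c.2 k else mid k.

(** After the arm codes, [c] holds the color of the center, the horizontal arm that may have many
    split lines, the middle color of the only split line of the opposite arm, and the middle colors
    of the former arm. Lines are numbered from 1, hence [k.-1]. *)
Definition code_mid (c : code) h up k : bool :=
  if h && (up == c.1.1.2)
  then (if insub k.-1 is Some i then c.2 i else false) else c.1.2.

Definition decode (c : code) : {set G} :=
  [set v | (v == vtx m m) && c.1.1.1.2 ||
    [exists p : bool * bool, [exists k : 'I_m, [exists a : 'I_3,
      (v == cell p.1 p.2 k.+1 a) &&
      arm_color (c.1.1.1.1 p) (code_mid c p.1 p.2) k.+1 a]]]].

Lemma decodeE A (c : code) : c.1.1.1.2 = (vtx m m \in A) ->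
  (forall h up k a, k < m -> a < 3 ->
     col A h up k.+1 a = arm_color (c.1.1.1.1 (h, up)) (code_mid c h up) k.+1 a) ->
  A = decode c.
Proof.
move=> c0 cE; apply/setP=> v; rewrite inE; apply/idP/orP.
  move=> vA; have [v0|[h [up [k [a [lt_k lt_a vE]]]]]] := cell_cover m_gt0 v.
    by left; rewrite v0 eqxx c0 -v0.
  right; apply/existsP; exists (h, up); apply/existsP; exists (Ordinal lt_k).
  apply/existsP; exists (Ordinal lt_a); rewrite /= vE eqxx /=.
  by rewrite -cE // /col -vE.
case=> [/andP[/eqP->]|]; first by rewrite c0.
case/existsP=> -[h up] /existsP[k] /existsP[a] /andP[/eqP->] /=.
by rewrite -cE // ltn_ord.
Qed.

(** Each of the four arms contributes [2 ^ 2 * m.+1 ^ 6]; the three single bits raise [2 ^ 8] to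
    [2 ^ 11], and [2 ^ m] counts the free middle vertices. *)
Lemma card_code : #|{: code}| = 2 ^ m * (2 ^ 11 * m.+1 ^ 24).
Proof.
rewrite !card_prod !card_ffun !card_prod !card_bool !card_ord.
rewrite [RHS]mulnC; congr (_ * _).
have -> : 2 * m.+1 * m.+1 * (2 * m.+1 * m.+1) * (m.+1 * m.+1) =
    2 ^ 2 * m.+1 ^ 6 by ring.
rewrite expnMn -!expnM /=; ring.
Qed.

Definition crossing_codes : {set Omega G} :=
  [set w : Omega G | [exists c : code, val w == [set decode c; ~: decode c]]].

Lemma card_crossing_codes : #|crossing_codes| <= #|{: code}|.
Proof.
rewrite -(card_imset _ val_inj).
apply: leq_trans (subset_leq_card _)
  (leq_imset_card (fun c : code => [set decode c; ~: decode c]) predT).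
apply/subsetP=> _ /imsetP[w + ->]; rewrite inE => /existsP[c /eqP->].
by apply/imsetP; exists c.
Qed.

Lemma leave_crossing (w w' : Omega G) (v : G) :
  w \in crossing m_gt0 -> w' \notin crossing m_gt0 ->
  flip (val w) v = val w' -> w \in crossing_codes.
Proof.
have [A [wA cA cB]] := OmegaP w.
rewrite (in_crossing m_gt0 wA) => /andP[sE sW].
move=> + ww'; have {ww'} wA' : val w' = [set toggle A v; ~: toggle A v].
  by rewrite -ww' wA flip_set2.
rewrite (in_crossing m_gt0 wA') => nsplit.
have [up nsplit_up] : exists up, ~~ splits m_gt0 (toggle A v) true up.
  by move: nsplit; rewrite negb_and => /orP[]; [exists true | exists false].
have s up' : splits m_gt0 A true up' by case: up'.
(* Toggling [v] destroys every split line of this arm, so [v] lies on each of them; as lines are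
   disjoint, there is only one. *)
have v_line k : k < m -> split m_gt0 A true up k.+1 ->
    exists2 a, a < 3 & v = cell true up k.+1 a.
  move=> lt_k sA.
  have nsA : ~~ split m_gt0 (toggle A v) true up k.+1.
    by move: nsplit_up; rewrite negb_exists => /forallP/(_ (Ordinal lt_k)).
  have [<-|n0] := eqVneq (cell true up k.+1 0) v; first by exists 0.
  have [<-|n2] := eqVneq (cell true up k.+1 2) v; first by exists 2.
  move: nsA sA; rewrite /split !in_toggle (negPf n0) (negPf n2) !addFb.
  by move/negPf->.
have [k0 sk0] : exists k0 : 'I_m, split m_gt0 A true up k0.+1.
  by have /existsP[k0] := s up; exists k0.
have one_split k : k < m -> split m_gt0 A true up k.+1 -> k = k0.
  move=> lt_k sk; have [a lt_a va] := v_line k lt_k sk.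
  have [b lt_b vb] := v_line k0 (ltn_ord k0) sk0.
  have /eqP := cell_line_inj (m_gt0 := m_gt0) (h := true) (up := up) (k := k.+1) (k' := k0.+1)
    lt_k (ltn_ord k0) lt_a lt_b (etrans (esym va) vb).
  by rewrite eqSS => /eqP.
have turns_gt0 up' : 0 < boundary_turns m_gt0 A true up'.
  by have /existsP[k sk] := s up'; apply: split_boundary_turns sk; rewrite ltn_ord.
have turns2 := sum_boundary_turns m_gt0 cA cB.
have no_split up' k : 0 < k <= m -> ~~ split m_gt0 A false up' k.
  move=> k_in; apply/negP=> /(split_boundary_turns k_in).
  by have := turns_gt0 true; have := turns_gt0 false; case: up'; lia.
have turns_le h up' : boundary_turns m_gt0 A h up' <= 2.
  by case: h; case: up'; lia.
(* Color changes of one outer row are among the at most two boundary turns of its arm. *)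
have row_ex h up' a : (a == 0) || (a == 2) -> exists c : row_code,
    forall k, 0 < k <= m -> col A h up' k a = two_switches c k.
  move=> a02; apply: two_switchesP => //.
  apply: leq_trans (turns_le h up'); apply: leq_trans (leq_addl _ _).
  by apply: leq_sum => k _; case/orP: a02 => /eqP->; rewrite ?leq_addr ?leq_addl.
have mono_ex h up' : exists c : 'I_m.+1 * 'I_m.+1,
    forall k, 0 < k <= m -> (runs A h up' k == 1) = ends_of c k.
  apply: ends_ofP => k k_in rk; exact: (mono_side cA cB k_in rk).
have arm_ex (p : bool * bool) : exists c : arm_code, forall k, 0 < k <= m ->
    [/\ col A p.1 p.2 k 0 = two_switches c.1.1 k,
        col A p.1 p.2 k 2 = two_switches c.1.2 k
      & (runs A p.1 p.2 k == 1) = ends_of c.2 k].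
  have [c0 c0E] := row_ex p.1 p.2 0 isT; have [c2 c2E] := row_ex p.1 p.2 2 isT.
  have [c1 c1E] := mono_ex p.1 p.2.
  by exists (c0, c2, c1) => k k_in; rewrite c0E ?c2E ?c1E.
have [F FE] := fin_all_exists arm_ex.
pose c : code := ([ffun p => F p], vtx m m \in A, ~~ up, col A true up k0.+1 1,
  [ffun k : 'I_m => col A true (~~ up) k.+1 1]).
rewrite inE wA; apply/existsP; exists c.
suff -> : A = decode c by [].
apply: decodeE => // h up' k a lt_k lt_a.
have k_in : 0 < k.+1 <= m by [].
rewrite /c /arm_color /= ffunE; have /= [<- <- <-] := FE (h, up') _ k_in.
case: a lt_a => [|[|[|//]]] _ //=.
case: eqVneq => [e|neq].
  by rewrite /runs -e; do 2!case: (col _ _ _ _ _).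
have sk : split m_gt0 A h up' k.+1 by [].
rewrite /code_mid /=; case: h neq sk => [_ sk|_ sk]; last first.
  by have := no_split up' k.+1 k_in; rewrite sk.
rewrite insubT ffunE /=; case: eqVneq => [->//|].
move=> up'E; have eup : up' = up by move: up'E; case: (up'); case: (up).
by rewrite eup in sk *; rewrite (one_split k).
Qed.

End CrossBoundary.

(** * Mixing time *)

Section Mixing.
Local Open Scope nat_scope.

(** Put [k = n./2], so that [n.+1 <= 2 * k.+1]. One factor [2 ^ k] absorbs the power [d] by
    induction, the other absorbs the remaining [k.+1]. *)
Lemma poly_leq_exp2 d C : exists n0, forall n, n0 <= n -> C * n.+1 ^ d <= 2 ^ n.
Proof.
elim: d C => [|d IHd] C.
  exists C => n le_n; rewrite muln1; apply: leq_trans le_n _.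
  exact/ltnW/ltn_expl.
have [k0 k0P] := IHd (C * 2 ^ d.+1); exists k0.*2 => n le_n.
set k := n./2; have le_k : k0 <= k by rewrite /k; lia.
apply: leq_trans (_ : C * (2 * k.+1) ^ d.+1 <= _).
  by rewrite leq_mul2l leq_exp2r // /k; lia.
apply: leq_trans (_ : 2 ^ k * 2 ^ k <= _); last by rewrite -expnD leq_exp2l // /k; lia.
rewrite expnMn mulnA [k.+1 ^ _]expnSr mulnA.
by rewrite leq_mul ?k0P // ltn_expl.
Qed.

Lemma card_cross_leq m (m_gt0 : 0 < m) : #|cross m.*2.+1| <= 6 * m.*2.+1.
Proof.
pose f (p : bool * 'I_m.*2.+1 * 'I_3) : cross m.*2.+1 :=
  if p.1.1 then vtx m_gt0 p.1.2 (m + p.2).-1 else vtx m_gt0 (m + p.2).-1 p.1.2.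
have -> : 6 * m.*2.+1 = #|{: bool * 'I_m.*2.+1 * 'I_3}|.
  by rewrite !card_prod card_bool !card_ord; lia.
rewrite -cardsT; apply: leq_trans (leq_imset_card f predT).
apply/subset_leq_card/subsetP=> v _; apply/imsetP.
rewrite -[v](vtxK m_gt0); move: (in_crossP m_gt0 v).
move: (px v) (py v) => x y; rewrite /in_cross => xy.
have [ys|ys] := boolP ((m <= y.+1) && (y <= m.+1)).
  have lt_x : x < m.*2.+1 by lia.
  have lt_y : y.+1 - m < 3 by lia.
  exists (true, Ordinal lt_x, Ordinal lt_y) => //.
  by rewrite /f /=; congr (vtx _ _); lia.
have lt_y : y < m.*2.+1 by lia.
have lt_x : x.+1 - m < 3 by lia.
exists (false, Ordinal lt_y, Ordinal lt_x) => //.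
by rewrite /f /=; congr (vtx _ _); lia.
Qed.

Lemma crossing_counts : exists m0, forall m t, m0 <= m ->
  2 ^ m.*2.+1 <= 4 * t * (2 ^ m * (2 ^ 11 * m.+1 ^ 24)) -> 2 ^ (m - m./2) <= t.
Proof.
(* Here [2 ^ 36] is [2 ^ 12 * 2 ^ 24]: the first factor is [4 * 2 ^ 11] after cancelling one 2, the
   second comes from [m.+1 <= 2 * (m./2).+1] raised to the power 24. *)
have [n0 n0P] := poly_leq_exp2 24 (2 ^ 36); exists n0.*2.+1 => m t le_m.
have le_n : n0 <= m./2 by lia.
have poly : 2 ^ 12 * m.+1 ^ 24 <= 2 ^ m./2.
  apply: leq_trans (n0P _ le_n); rewrite (expnD 2 12 24) -mulnA leq_mul2l -expnMn.
  by rewrite leq_exp2r //; lia.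
have -> : 2 ^ m.*2.+1 = 2 ^ m * (2 * 2 ^ m) by rewrite -expnS -expnD; congr (_ ^ _); lia.
have -> : 4 * t * (2 ^ m * (2 ^ 11 * m.+1 ^ 24)) = 2 ^ m * (2 * (t * (2 ^ 12 * m.+1 ^ 24))).
  by rewrite (expnD 2 1 11) [4 * t]mulnC; ring.
rewrite leq_pmul2l ?expn_gt0 // leq_pmul2l // => le_t.
rewrite -(leq_pmul2r (expn_gt0 2 m./2 : 0 < _)) -expnD subnK; last by lia.
by apply: leq_trans le_t _; rewrite leq_mul2l poly orbT.
Qed.

End Mixing.

Section CrossMixing.
Variables (R : realType) (m : nat).
Hypothesis m_gt0 : (0 < m)%N.

Local Notation G := (cross m.*2.+1).

Lemma cross_gt0 : (0 < #|G|)%N.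
Proof. by apply/card_gt0P; exists (center m_gt0). Qed.

Lemma cross_mixing_time (B : R) :
  (forall t : nat, (2 ^ m.*2.+1 <= 4 * t * (2 ^ m * (2 ^ 11 * m.+1 ^ 24)))%N -> B <= t%:R) ->
  (B%:E <= mixing_time (@glauber G R) (uniform R (Omega G)))%E.
Proof.
move=> leB; have G2 := cross_biconnected m_gt0.
apply: (@mixing_time_ge _ _ _ _ _ _ (crossing m_gt0) (2 ^ m.*2.+1)
  (#|crossing_codes m_gt0|%:R)).
- exact: glauber_ge0.
- exact: (glauber_sum1 R cross_gt0).
- exact: glauber_sym.
- exact: leq_crossing.
- exact: leq_not_crossing.
- by apply: (glauber_flow_le _ cross_gt0) => w w' v; apply: leave_crossing.
move=> t; rewrite -!natrM ler_nat => le_t; apply: leB.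
by apply: leq_trans le_t _; rewrite leq_mul2l -card_code card_crossing_codes orbT.
Qed.

End CrossMixing.

Theorem mainTheorem3 (R : realType) :
  (forall l : nat, odd l -> (3 <= l)%N ->
     [/\ k_connected 2 (cross l),
         (bandwidth (cross l) <= 12)%N
       & ergodic (@glauber (cross l) R)]) /\
  (exists2 c : R, 0 < c &
     exists l0 : nat, forall l : nat, odd l -> (l0 <= l)%N ->
       exists pi : {ffun Omega (cross l) -> R},
         [/\ unique (stationary (@glauber (cross l) R)) pi,
             ((2 `^ (c * l%:R))%:E
                <= mixing_time (@glauber (cross l) R) pi)%E
           & ((2 `^ (c * #|cross l|%:R))%:E
                <= mixing_time (@glauber (cross l) R) pi)%E]).
Proof.
have oddE l : odd l -> (3 <= l)%N -> exists2 m, l = m.*2.+1 & (0 < m)%N.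
  by exists l./2; lia.
split=> [l l_odd l_ge3|].
  have [m -> m_gt0] := oddE l l_odd l_ge3.
  have G2 := cross_biconnected m_gt0; split; first exact: G2.
    exact: (cross_bandwidth m_gt0).
  exact: (glauber_ergodic R (cross_gt0 m_gt0) G2).
(* Both [l] and [#|cross l|] are at most 18m, since [#|cross l| <= 6 * l] and [l <= 3 * m]; and 18m
   / 36 = m / 2 is at most the exponent [m - m./2] of [crossing_counts]. *)
exists 36^-1; first by rewrite invr_gt0.
have [m0 m0P] := crossing_counts; exists (m0.*2 + 3)%N => l l_odd le_l.
have [m lE m_gt0] : exists2 m, l = m.*2.+1 & (0 < m)%N by apply: oddE => //; lia.
have {le_l} le_m : (m0 <= m)%N by lia.
rewrite {l l_odd}lE; have G2 := cross_biconnected m_gt0.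
exists (uniform R (Omega (cross m.*2.+1))).
have bound (n : nat) : (n <= 18 * m)%N ->
    ((2 `^ (36^-1 * n%:R))%:E <= mixing_time (@glauber (cross m.*2.+1) R)
       (uniform R (Omega (cross m.*2.+1))))%E.
  move=> le_n; apply: cross_mixing_time m_gt0 _ _ => t /(m0P _ _ le_m) le_t.
  apply: le_trans (_ : (2 ^ (m - m./2))%:R <= _); last by rewrite ler_nat.
  rewrite natrX -powR_mulrn ?ler0n // ler_powR ?ler1n //.
  by rewrite ler_pdivrMl // -natrM ler_nat; lia.
split; last 1 first.
- by apply: bound; have := card_cross_leq m_gt0; lia.
- exact: (glauber_unique_stationary R (cross_gt0 m_gt0) G2).
by apply: bound; lia.
Qed.
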